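(* Let $\mathcal{H}$ be an infinite-dimensional separable Hilbert space, let $\{g_j\}_{j\in\Lambda}\subset\mathcal{H}$ be a Bessel sequence with Bessel bound $\beta>0$, let $W$ be a closed subspace of $\mathcal{H}$ with orthogonal projection $P_W$ onto $W$, and let $A$ be a bounded linear operator on $\mathcal{H}$ with spectral radius $\rho(A)<1$. Consider the non-uniform discrete dynamical system generated by $A$ with initial states $x_0,x_{-2}\in\mathcal{H}$ and source term $w\in W$. Then each source term $w\in W$ can be stably recovered from the measurements $D(x_0,x_{-2},w)=[\langle x_\lambda,g_j\rangle]_{\lambda,j\in\Lambda}$ (in infinitely many time iterations) if and only if $\{P_W(I-A^* )^{-1}g_j\}_{j\in\Lambda}$ is a frame for $W$.
   Context: Let $N\in\mathbb{N}$, $N\ge1$, and let $r$ be a fixed odd integer coprime with $N$ with $1\le r\le 2N-1$. Put $\Lambda=\{0,\tfrac{r}{N}\}+2\mathbb{Z}\subset\mathbb{R}$. $\mathbb{Z}^+$ and $\mathbb{Z}^-$ denote the positive and negative integers. The Hilbert space $\mathcal{H}$ is real or complex with scalar field $\mathbb{F}\in\{\mathbb{R},\mathbb{C}\}$; all sequences and matrices have entries in $\mathbb{F}$. Non-uniform discrete dynamical system: given a bounded linear operator $A$ on $\mathcal{H}$, a closed subspace $W$ of $\mathcal{H}$, a source term $w\in W$ and initial states $x_0,x_{-2}\in\mathcal{H}$, the states $x_\lambda\in\mathcal{H}$, $\lambda\in\Lambda$, are determined by $$x_{\lambda+\frac rN}=Ax_\lambda+w\ (\lambda\in2\mathbb{Z}),\quad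 x_{\lambda+2-\frac rN}=Ax_\lambda+w\ (\lambda\in(2\mathbb{Z}^++\tfrac rN)\cup\{\tfrac rN\}),\quad x_{\lambda-2-\frac rN}=Ax_\lambda+w\ (\lambda\in2\mathbb{Z}^-+\tfrac rN).$$ Bessel sequence with Bessel bound $\beta$: $\sum_{j}|\langle f,g_j\rangle|^2\le\beta\|f\|^2$ for all $f\in\mathcal{H}$. A family $\{f_j\}_{j\in\Lambda}\subset W$ is a frame for $W$ if there are constants $\alpha_0,\beta_0>0$ with $\alpha_0\|f\|^2\le\sum_{j}|\langle f,f_j\rangle|^2\le\beta_0\|f\|^2$ for all $f\in W$. $\mathcal{B}(\ell^2(\Lambda),\ell^\infty(\Lambda))$ is the space of matrices $T=[a_{ij}]_{i,j\in\Lambda}$ whose rows $r_i=(a_{ij})_{j\in\Lambda}$ all belong to $\ell^2(\Lambda)$ with $\|T\|=\sup_{i\in\Lambda}\|r_i\|_{\ell^2(\Lambda)}<\infty$. $\mathcal{B}^{s}(\ell^2(\Lambda),\ell^\infty(\Lambda))$ is the subspace, with the induced norm, of those $T$ for which there is $z\in\ell^2(\Lambda)$ with $\lim_{|i|\to\infty}\|r_i-z\|_{\ell^2(\Lambda)}=0$ (limit over $i\in\Lambda\subset\mathbb{R}$). The source terms $w\in W$ can be stably recovered in infinitely many time iterations if there is a bounded linear operator $\mathscr{R}:\mathcal{B}^{s}(\ell^2(\Lambda),\ell^\infty(\Lambda))\to\mathcal{H}$ such that, for all $x_0,x_{-2}\in\mathcal{H}$ and all $w\in W$, the data matrix $D(x_0,x_{-2},w)$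 (which lies in $\mathcal{B}^{s}(\ell^2(\Lambda),\ell^\infty(\Lambda))$) satisfies $\mathscr{R}(D(x_0,x_{-2},w))=w$. *)

(* Defs.v *)
From HB Require Import structures.
From mathcomp Require Import all_boot all_order all_algebra sesquilinear.
From mathcomp Require Import all_classical all_reals all_analysis.
From mathcomp Require Import complex.
From mathcomp Require Import zify ring lra.

Set Implicit Arguments.
Unset Strict Implicit.
Unset Printing Implicit Defensive.

Import Order.TTheory GRing.Theory Num.Theory.
Import numFieldNormedType.Exports.

Local Open Scope classical_set_scope.
Local Open Scope ring_scope.

Inductive field_kind := RealScalars | ComplexScalars.

Definition scalarF (R : realType) (k : field_kind) : numFieldType :=
  match k with RealScalars => R | ComplexScalars => R[i] end.

Definition conjF {R : realType} {k : field_kind} : scalarF R k -> scalarF R k :=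
  match k with RealScalars => fun x => x | ComplexScalars => @Num.conj R[i] end.

Definition reF {R : realType} {k : field_kind} : scalarF R k -> R :=
  match k with RealScalars => fun x => x | ComplexScalars => @complex.Re R end.

Section ConjF.
Context {R : realType} {k : field_kind}.

Lemma conjF_is_zmod_morphism : zmod_morphism (@conjF R k).
Proof. by case: k => // x y; exact: rmorphB. Qed.

Lemma conjF_is_monoid_morphism : monoid_morphism (@conjF R k).
Proof.
by case: k; split => //=; [exact: rmorph1 | move=> x y; exact: rmorphM].
Qed.

Lemma conjFK : involutive (@conjF R k).
Proof. by case: k => // x; exact: conjCK. Qed.

HB.instance Definition _ := GRing.isZmodMorphism.Build (scalarF R k)
  (scalarF R k) conjF conjF_is_zmod_morphism.
HB.instance Definition _ := GRing.isMonoidMorphism.Build (scalarF R k)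
  (scalarF R k) conjF conjF_is_monoid_morphism.
HB.instance Definition _ := isInvolutive.Build (scalarF R k) conjF conjFK.

End ConjF.

(* The norm of a module over [scalarF R k] takes its values in [scalarF R k];
   [rnorm] is the same number seen in R. It also applies to scalars. *)
Definition rnorm {R : realType} {k : field_kind}
  {V : normedZmodType (scalarF R k)} (x : V) : R := reF `|x|.

Section Hilbert.
Context {R : realType} {k : field_kind}.
Local Notation K := (scalarF R k).

(* [dot] is linear in its first argument and conjugate-linear in its second;
   completeness is part of [completeNormedModType]. *)
Definition hilbert_norm (H : completeNormedModType K) (dot : {dot H for conjF})
  := forall x : H, dot x x = `|x| ^+ 2.

Definition separable_space (T : topologicalType) :=
  exists S : set T, countable S /\ dense S.

Definition infinite_dimensional (V : lmodType K) :=
  ~ exists n (e : 'I_n -> V),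
      forall x, exists c : 'I_n -> K, x = \sum_i c i *: e i.

Definition closed_subspace (V : normedModType K) (W : set V) :=
  [/\ closed W, W 0 & forall (a : K) u v, W u -> W v -> W (a *: u + v)].

Variables (H : completeNormedModType K) (dot : {dot H for conjF}).

Definition orth_proj (W : set H) (f : H) : H :=
  xget 0 [set p | W p /\ forall v, W v -> dot (f - p) v = 0].

Definition adjoint (A : H -> H) (y : H) : H :=
  xget 0 [set z | forall x, dot (A x) y = dot x z].

Definition opinv (T : H -> H) : H -> H := 'pinv_(fun=> 0) [set: H] T.

Definition bessel (J : choiceType) (g : J -> H) (beta : R) :=
  forall f : H,
    (\esum_(j in [set: J]) (rnorm (dot f (g j)) ^+ 2)%:E <=
     (beta * rnorm f ^+ 2)%:E)%E.

Definition is_frame (J : choiceType) (W : set H) (f : J -> H) :=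
  (forall j, W (f j)) /\
  exists alpha0 beta0 : R, [/\ 0 < alpha0, 0 < beta0 &
    forall h, W h ->
      ((alpha0 * rnorm h ^+ 2)%:E <=
         \esum_(j in [set: J]) (rnorm (dot h (f j)) ^+ 2)%:E <=
       (beta0 * rnorm h ^+ 2)%:E)%E].

End Hilbert.

Definition invertible_op {K : numFieldType} {V : normedModType K}
    (T : V -> V) :=
  exists S : {linear V -> V}, [/\ continuous S, cancel S T & cancel T S].

(* Over the reals, the spectrum is that of the complexification of [A]: the
   pair [(x, y)] stands for [x + iy], and [l] acts on it as the complex
   scalar [Re l + i Im l]. *)
Definition spectrum {R : realType} {k : field_kind} :
    forall V : normedModType (scalarF R k), (V -> V) -> set R[i] :=
  match k with
  | RealScalars => fun V A => [set l | ~ invertible_op (fun p : V * V =>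
      (complex.Re l *: p.1 - complex.Im l *: p.2 - A p.1,
       complex.Im l *: p.1 + complex.Re l *: p.2 - A p.2))]
  | ComplexScalars => fun V A =>
      [set l | ~ invertible_op (fun x : V => l *: x - A x)]
  end.

Definition spectral_radius {R : realType} {k : field_kind}
    {V : normedModType (scalarF R k)} (A : V -> V) : \bar R :=
  ereal_sup [set (complex.Re `|l|)%:E | l in spectrum A].

Section IndexSet.
Variable R : realType.

Definition evenZ : set R := [set 2 * m%:~R | m in [set: int]].
Definition evenZpos : set R := [set 2 * m%:~R | m in [set m : int | 0 < m]].
Definition evenZneg : set R := [set 2 * m%:~R | m in [set m : int | m < 0]].

Variables N r : nat.

Definition rN : R := r%:R / N%:R.

Definition LambdaNr : set R :=
  [set a + b | a in [set 0; rN] & b in evenZ].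

End IndexSet.

Arguments evenZ : clear implicits.
Arguments evenZpos : clear implicits.
Arguments evenZneg : clear implicits.
Arguments LambdaNr : clear implicits.

Section System.
Context {R : realType} {k : field_kind} {H : normedModType (scalarF R k)}.
Variables N r : nat.
Local Notation L := (LambdaNr R N r).
Local Notation rN := (rN R N r).

(* [x] is the family of states: its values are forced by the initial states
   (see [states_exist] and [states_unique]). *)
Definition is_states (A : H -> H) (x0 xm2 w : H) (x : L -> H) :=
  [/\ forall l : L, val l = 0 -> x l = x0,
      forall l : L, val l = - 2 -> x l = xm2,
      forall l l' : L, evenZ R (val l) -> val l' = val l + rN ->
        x l' = A (x l) + w,
      forall l l' : L,
        ([set a + rN | a in evenZpos R] `|` [set rN]) (val l) ->
        val l' = val l + 2 - rN -> x l' = A (x l) + w &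
      forall l l' : L, [set a + rN | a in evenZneg R] (val l) ->
        val l' = val l - 2 - rN -> x l' = A (x l) + w].

Lemma even_LambdaNr (m : int) : L (2 * m%:~R).
Proof. by exists 0; [left|exists (2 * m%:~R); [exists m|rewrite add0r]]. Qed.

Lemma odd_LambdaNr (m : int) : L (rN + 2 * m%:~R).
Proof. by exists rN; [right|exists (2 * m%:~R); [exists m|]]. Qed.

Let ev (m : int) : L := SigSub (mem_set (even_LambdaNr m)).
Let od (m : int) : L := SigSub (mem_set (odd_LambdaNr m)).

Lemma LambdaNr_ind (P : L -> Prop) :
  (forall m l, val l = 2 * m%:~R -> P l) ->
  (forall m l, val l = rN + 2 * m%:~R -> P l) -> forall l, P l.
Proof.
move=> Pe Po l; have Ll : L (val l) by apply: set_mem; exact: valP.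
case: Ll => a [->|->] [b [m _ <-]] abl.
  by apply: (Pe m); rewrite -abl add0r.
by apply: (Po m); rewrite -abl.
Qed.

Hypotheses (N_gt0 : (0 < N)%N) (odd_r : odd r).

Lemma rN_neq_even (m n : int) : rN + 2 * m%:~R <> 2 * n%:~R :> R.
Proof.
have N0 : N%:R != 0 :> R by rewrite pnatr_eq0 -lt0n.
move=> /eqP; rewrite -subr_eq0 /Defs.rN => /eqP H0.
have : (r%:Z + 2 * m * N%:Z - 2 * n * N%:Z)%:~R = 0 :> R.
  rewrite rmorphB rmorphD/= !rmorphM/= -!pmulrn.
  transitivity (N%:R * (r%:R / N%:R + 2 * m%:~R - 2 * n%:~R : R)); first by field.
  by rewrite H0 mulr0.
move=> /eqP; rewrite intr_eq0 => /eqP.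
have -> : r = (r./2.*2).+1 by rewrite -[LHS]odd_double_half odd_r.
lia.
Qed.

Lemma even_inj (m n : int) : 2 * m%:~R = 2 * n%:~R :> R -> m = n.
Proof. by move=> /mulfI mn; apply/(@intr_inj R)/mn. Qed.

Definition states_of (A : H -> H) (x0 xm2 w : H) : L -> H := fun l =>
  let S y := A y + w in
  let E (m : int) := match m with
    | Posz n => iter n.*2 S x0 | Negz n => iter n.*2 S xm2 end in
  if pselect (exists m : int, val l = 2 * m%:~R) is left h then E (projT1 (cid h))
  else if pselect (exists m : int, val l = rN + 2 * m%:~R) is left h
  then S (E (projT1 (cid h))) else 0.

Lemma states_of_even A x0 xm2 w l (m : int) : val l = 2 * m%:~R ->
  states_of A x0 xm2 w l = match m with
    | Posz n => iter n.*2 (fun y => A y + w) x0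
    | Negz n => iter n.*2 (fun y => A y + w) xm2 end.
Proof.
move=> lm; rewrite /states_of; case: pselect => [h|[]]; last by exists m.
by case: cid => n /=; rewrite lm => /even_inj ->.
Qed.

Lemma states_of_odd A x0 xm2 w l (m : int) : val l = rN + 2 * m%:~R ->
  states_of A x0 xm2 w l = A (match m with
    | Posz n => iter n.*2 (fun y => A y + w) x0
    | Negz n => iter n.*2 (fun y => A y + w) xm2 end) + w.
Proof.
move=> lm; rewrite /states_of; case: pselect => [h|_].
  by exfalso; case: h => n; rewrite lm; exact: rN_neq_even.
case: pselect => [h|[]]; last by exists m.
by case: cid => n /=; rewrite lm => /addrI/even_inj ->.
Qed.

Lemma states_exist A x0 xm2 w : exists x : L -> H, is_states A x0 xm2 w x.
Proof.
exists (states_of A x0 xm2 w); split.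
- by move=> l l0; rewrite (@states_of_even _ _ _ _ _ 0)//= l0 mulr0.
- by move=> l l0; rewrite (@states_of_even _ _ _ _ _ (- 1))//= l0 mulrN1.
- move=> l l' [m _ /esym lm] l'E; rewrite (states_of_even _ _ _ _ lm).
  by rewrite (@states_of_odd _ _ _ _ l' m)// l'E lm addrC.
- move=> l l' lm l'E.
  have {lm} [n ln] : exists n : nat, val l = rN + 2 * n%:~R.
    case: lm => [[_ [[n|n] // n0 <-] <-]|->]; first by exists n; rewrite addrC.
    by exists 0%N; rewrite mulr0 addr0.
  rewrite (@states_of_odd _ _ _ _ l n)// (@states_of_even _ _ _ _ l' n.+1)//.
  by rewrite l'E ln -!pmulrn -natr1; ring.
- move=> l l' [_ [[n|n] // n0 <-] ln] l'E; rewrite addrC in ln.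
  rewrite (@states_of_odd _ _ _ _ l (Negz n))//.
  rewrite (@states_of_even _ _ _ _ l' (Negz n.+1))//.
  by rewrite l'E -ln !NegzE !rmorphN/= -!pmulrn -[n.+2%:R]natr1; ring.
Qed.

Lemma states_unique A x0 xm2 w (x y : L -> H) :
  is_states A x0 xm2 w x -> is_states A x0 xm2 w y -> x = y.
Proof.
move=> [x1 x2 x3 x4 x5] [y1 y2 y3 y4 y5].
have step m : x (ev m) = y (ev m) -> x (od m) = y (od m).
  move=> xy; have e : evenZ R (val (ev m)) by exists m.
  have ee : val (od m) = val (ev m) + rN by rewrite /= addrC.
  by rewrite (x3 _ _ e ee) (y3 _ _ e ee) xy.
have E m : x (ev m) = y (ev m).
  case: m => [] n; elim: n => [|n /step IH].
  - by rewrite x1 ?y1//= mulr0.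
  - have e : ([set a + rN | a in evenZpos R] `|` [set rN]) (val (od n)).
      case: n {IH} => [|n]; first by right; rewrite /= mulr0 addr0.
      by left; exists (2 * n.+1%:~R); [exists n.+1|rewrite /= addrC].
    have ee : val (ev n.+1) = val (od n) + 2 - rN.
      by rewrite /= -!pmulrn -natr1; ring.
    by rewrite (x4 _ _ e ee) (y4 _ _ e ee) IH.
  - by rewrite x2 ?y2//= mulrN1.
  - have e : [set a + rN | a in evenZneg R] (val (od (Negz n))).
      by exists (2 * (Negz n)%:~R); [exists (Negz n)|rewrite /= addrC].
    have ee : val (ev (Negz n.+1)) = val (od (Negz n)) - 2 - rN.
      by rewrite /= !NegzE !rmorphN/= -!pmulrn -[n.+2%:R]natr1; ring.
    by rewrite (x5 _ _ e ee) (y5 _ _ e ee) IH.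
apply/funext; apply: LambdaNr_ind => m l lm.
  by have -> : l = ev m by exact/val_inj.
by have -> : l = od m; [exact/val_inj | exact: step].
Qed.

End System.

Section Matrices.
Context {R : realType} {k : field_kind}.
Local Notation K := (scalarF R k).
Variable L : set R.

Definition l2norm (a : L -> K) : \bar R :=
  ((\esum_(j in [set: L]) (rnorm (a j) ^+ 2)%:E) `^ 2^-1)%E.

Definition in_l2 (a : L -> K) := (l2norm a < +oo)%E.

Definition mxnorm (T : L -> L -> K) : \bar R :=
  ereal_sup [set l2norm (T i) | i in [set: L]].

Definition Bl2 (T : L -> L -> K) :=
  (forall i, in_l2 (T i)) /\ (mxnorm T < +oo)%E.

Definition Bs (T : L -> L -> K) := Bl2 T /\
  exists2 z : L -> K, in_l2 z &
    forall e : R, 0 < e -> exists M : R, forall i : L, M < `|val i| ->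
      (l2norm (fun j => (T i j - z j)%R) < e%:E)%E.

(* Bounded linear operators from [Bs] are functions on all matrices of which
   only the restriction to [Bs] is constrained (and used). *)
Definition bounded_linear_on_Bs (V : normedModType K)
    (F : (L -> L -> K) -> V) :=
  (forall (a : K) S T, Bs S -> Bs T ->
     F (fun i j => a * S i j + T i j) = a *: F S + F T) /\
  exists C : R, forall T, Bs T -> ((rnorm (F T))%:E <= C%:E * mxnorm T)%E.

End Matrices.

Section Recovery.
Context {R : realType} {k : field_kind}.
Variables (H : completeNormedModType (scalarF R k)) (dot : {dot H for conjF}).
Variables N r : nat.
Local Notation L := (LambdaNr R N r).

Definition data_matrix (g x : L -> H) : L -> L -> scalarF R k :=
  fun l j => dot (x l) (g j).

Definition stably_recoverable (A : H -> H) (g : L -> H) (W : set H) :=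
  exists2 Rec : (L -> L -> scalarF R k) -> H, bounded_linear_on_Bs Rec &
    forall x0 xm2 w x, W w -> is_states A x0 xm2 w x ->
      Bs (data_matrix g x) /\ Rec (data_matrix g x) = w.

End Recovery.

(* Main.v *)
(* If [rho(A) < 1] then [A ^ n -> 0], and every state is [u + A ^ n y] with
   [u = (I - A)^-1 w], so the rows of the data matrix converge in l^2 to
   [<u, g_j> = <w, f_j>], where [f_j = P_W (I - A^* )^-1 g_j]. Starting the system
   at [u] makes all rows equal to this limit, so a bounded recovery operator
   gives the lower frame bound; the upper one is the Bessel bound of [g].
   Conversely, if [f] is a frame, then projecting the limit of the rows onto the
   closed range of the analysis operator and inverting that operator there
   recovers [w]. *)
Require Import Defs.
From HB Require Import structures.
From mathcomp Require Import all_boot all_order all_algebra sesquilinear.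
From mathcomp Require Import all_classical all_reals all_analysis.
From mathcomp Require Import complex.
From mathcomp Require Import ring lra.
Import Order.TTheory GRing.Theory Num.Theory.
Import numFieldNormedType.Exports.
Set Implicit Arguments.
Unset Strict Implicit.
Unset Printing Implicit Defensive.
Local Open Scope classical_set_scope.
Local Open Scope ring_scope.

(** The spectral hypothesis enters twice: 1 lies outside the spectrum, so [I - A] has a bounded
    inverse, and the resolvent on and outside the unit circle has to be turned into decay of the
    powers of [A]. For real scalars the spectrum is that of the complexification, whose sup norm is
    homogeneous for complex scalars only up to a factor; this dictates the generality in which the
    contraction is proved. The projection onto [W], the adjoint (through Riesz) and the
    least-squares fit of a row by the range of the analysis operator all rest on one minimisation
    principle for functionals that obey a parallelogram law, so l^2 enters only through sums of
    squares. Negative times are not a backward evolution: from the state at -2 the system is again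
    driven forward by [A], towards minus infinity. Hence the rows approach the same limit along both
    ends of the index set. *)

Section ComplexModulus.
Variable R : realType.
Implicit Types z w : R[i].

Definition cabs z : R := complex.Re `|z|.

Lemma cabsE z : (cabs z)%:C%C = `|z|.
Proof. by rewrite /cabs normc_def. Qed.

Lemma cabs_ge0 z : 0 <= cabs z.
Proof. by rewrite -lecR cabsE normr_ge0. Qed.

Lemma cabsM z w : cabs (z * w) = cabs z * cabs w.
Proof. by apply: complexI; rewrite rmorphM /= !cabsE normrM. Qed.

Lemma cabsX z n : cabs (z ^+ n) = cabs z ^+ n.
Proof. by apply: complexI; rewrite rmorphXn /= !cabsE normrX. Qed.

Lemma cabsN z : cabs (- z) = cabs z.
Proof. by rewrite /cabs normrN. Qed.

Lemma cabs_real (a : R) : cabs a%:C%C = `|a|.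
Proof. by rewrite /cabs normc_def /= expr0n /= addr0 sqrtr_sqr. Qed.

Lemma cabs1 : cabs 1 = 1.
Proof. by rewrite /cabs normr1. Qed.

Lemma cabsV z : cabs z^-1 = (cabs z)^-1.
Proof. by apply: complexI; rewrite fmorphV /= !cabsE normfV. Qed.

Lemma sqr_cabs z : cabs z ^+ 2 = complex.Re z ^+ 2 + complex.Im z ^+ 2.
Proof. by rewrite /cabs normc_def /= sqr_sqrtr// addr_ge0 ?sqr_ge0. Qed.

Lemma cabs_le_ReIm (a b d : R) : `|a| <= d -> `|b| <= d ->
  cabs (a +i* b)%C <= 2 * d.
Proof.
move=> ad bd; have d0 : 0 <= d := le_trans (normr_ge0 a) ad.
rewrite -ler_sqr ?nnegrE ?cabs_ge0 ?mulr_ge0// sqr_cabs /=.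
rewrite -[a ^+ 2]real_normK ?num_real// -[b ^+ 2]real_normK ?num_real//.
have := normr_ge0 a; have := normr_ge0 b; nra.
Qed.

(** Multiplying [z] by such a [w] turns [1 - (z B) ^ n] into [1 + (z B) ^ n] without leaving the
    disc. *)
Lemma root_opp1 n : (0 < n)%N -> exists2 w, cabs w = 1 & w ^+ n = -1.
Proof.
move=> n0; have wn := rootCK n0 (-1 : R[i]); exists (n.-root (-1)) => //.
apply/eqP; rewrite -(@eqrXn2 _ n) ?cabs_ge0//.
by rewrite -cabsX wn expr1n cabsN cabs1.
Qed.

End ComplexModulus.

(* Rickart's elementary proof of the spectral radius formula. If the resolvent
   of [B] exists on the closed unit disc, then averaging it over square roots
   gives left inverses [F m z] of [1 - (z B) ^ (2 ^ m)] that are bounded and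
   Lipschitz in [z] uniformly in [m]. Hence the set of [s] in [0, 1] for which
   some [(s B) ^ (2 ^ m)] is a contraction is stable under steps of a fixed
   length, and contains 1. The norm need only be homogeneous up to a factor
   for complex scalars, which allows the sup norm on a complexification. *)
Section SquaringContraction.
Variables (R : realType) (E : lmodType R[i]) (nrm : E -> R) (C b : R).
Variable B : {linear E -> E}.
Hypothesis nrmD : forall x y, nrm (x + y) <= nrm x + nrm y.
Hypothesis nrmR : forall (a : R) x, nrm (a%:C%C *: x) = `|a| * nrm x.
Hypothesis nrmZ : forall z x, nrm (z *: x) <= C * cabs z * nrm x.
Hypothesis nrm_ge0 : forall x, 0 <= nrm x.
Hypothesis C_ge0 : 0 <= C.
Hypothesis b_gt0 : 0 < b.
Hypothesis nrmB : forall x, nrm (B x) <= b * nrm x.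
Hypothesis resolvent : forall z, cabs z <= 1 -> exists Q : E -> E, exists M,
  [/\ forall x, Q (x - z *: B x) = x, forall y, Q y - z *: B (Q y) = y &
      forall y, nrm (Q y) <= M * nrm y].

Let nrmN x : nrm (- x) = nrm x.
Proof.
have := nrmR (-1) x; rewrite normrN1 mul1r => <-.
by rewrite rmorphN /= rmorph1 scaleN1r.
Qed.

Lemma iter_lin n (a : R[i]) x y :
  iter n B (a *: x + y) = a *: iter n B x + iter n B y.
Proof. by elim: n => //= n ->; rewrite linearP. Qed.

Let iterZ n (a : R[i]) x : iter n B (a *: x) = a *: iter n B x.
Proof.
have i0 : iter n B 0 = 0 by elim: n => //= n ->; rewrite raddf0.
by rewrite -[a *: x]addr0 iter_lin i0 addr0.
Qed.

(** Each resolvent comes with its own bound. By perturbation twice that bound is valid on a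
    neighbourhood, and compactness of the closed disc, seen as a set of pairs of reals, makes it
    uniform. *)
Lemma resolvent_bound : exists2 M, 0 < M & forall z, cabs z <= 1 ->
  forall x, nrm x <= M * nrm (x - z *: B x).
Proof.
pose K : set (R * R) := [set p | p.1 ^+ 2 + p.2 ^+ 2 <= 1].
have Kcompact : compact K.
  apply: (@subclosed_compact _ _
    ([set` `[-1, 1]%R] `*` [set` `[-1, 1]%R] : set (R * R))).
  - have -> : K = (fun p => p.1 ^+ 2 + p.2 ^+ 2) @^-1` [set x | x <= 1] by [].
    apply: closed_comp; last exact: closed_le.
    move=> p _; apply: cvgD; apply: cvgM;
      by [exact: cvg_fst | exact: cvg_snd].
  - by apply: compact_setX; exact: segment_compact.
  - move=> [p q]; rewrite /K /= !in_itv /= => pq.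
    by split; apply/andP; split; have := sqr_ge0 p; have := sqr_ge0 q; nra.
(* Compactness as near-covering: an estimate that holds near each point for all large [M] holds on
   the whole disc for all large [M]. *)
have /compact_near_coveringP/(_ R (pinfty_nbhs R)
  (fun M p => forall x, nrm x <= M * nrm (x - (p.1 +i* p.2)%C *: B x)) _) :=
  Kcompact.
case => [[a c] Kac|M [_ MP]].
  have : cabs (a +i* c)%C <= 1.
    by rewrite -(@ler_pXn2r _ 2) ?nnegrE ?cabs_ge0// sqr_cabs expr1n.
  move=> /resolvent [Q [M0 [QK _ QM]]].
  pose M1 := Num.max 1 M0.
  have M1_gt0 : 0 < M1 by rewrite lt_max ltr01.
  have low x : nrm x <= M1 * nrm (x - (a +i* c)%C *: B x).
    rewrite -{1}(QK x) (le_trans (QM _))// ler_wpM2r//.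
    by rewrite le_max lexx orbT.
  (* With this radius [M1 * (C + 1) * (2 * d) * b] equals 1/2, so the perturbation costs at most
     half of [nrm x]. The summand 1 guards against [C = 0]. *)
  pose d := (4 * (C + 1) * b * M1)^-1.
  have d0 : 0 < d by rewrite invr_gt0 !mulr_gt0// ltr_wpDl.
  near=> p M => /= x.
  have Mbig : 2 * M1 <= M by near: M; apply: nbhs_pinfty_ge; exact: num_real.
  have pa : `|p.1 - a| <= d.
    near: p; by apply: cvgr_distC_le => //; exact: cvg_fst.
  have pc : `|p.2 - c| <= d.
    near: p; by apply: cvgr_distC_le => //; exact: cvg_snd.
  apply: (@le_trans _ _ (2 * M1 * nrm (x - (p.1 +i* p.2)%C *: B x))); last first.
    by rewrite ler_wpM2r.
  set y := x - (p.1 +i* p.2)%C *: B x.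
  set z := ((p.1 - a) +i* (p.2 - c))%C.
  have -> : nrm x = 2 * nrm x - nrm x by ring.
  have xE : x - (a +i* c)%C *: B x = y + z *: B x.
    have -> : z = (p.1 +i* p.2)%C - (a +i* c)%C by [].
    by rewrite scalerBl /y addrA subrK.
  have zd : cabs z <= 2 * d by exact: cabs_le_ReIm.
  have h1 := low x; rewrite xE in h1.
  have h2 := nrmD y (z *: B x).
  have h3 := nrmZ z (B x).
  have h4 := nrmB x.
  have h5 : M1 * (C * cabs z * nrm (B x)) <= nrm x / 2.
    apply: (@le_trans _ _ (M1 * ((C + 1) * (2 * d) * (b * nrm x)))).
      rewrite ler_pM2l// ler_pM// ?mulr_ge0 ?cabs_ge0//.
      by rewrite ler_pM ?cabs_ge0// lerDl.
    rewrite le_eqVlt; apply/orP; left; apply/eqP; rewrite /d; field.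
    by rewrite !gt_eqF// ltr_wpDl.
  nra.
have [M1 M1M M1_gt0] : exists2 M1, M < M1 & 0 < M1.
  by exists (Num.max M 0 + 1); rewrite ltr_pwDr// le_max lexx ?orbT.
exists M1 => // -[p q] zle x; apply: (MP M1 M1M (p, q)).
by rewrite /K /= -(sqr_cabs (p +i* q)%C) expr_le1// cabs_ge0.
Unshelve. all: by end_near. Qed.


Lemma inverse_family : exists2 M, 0 < M & forall m, exists F : R[i] -> E -> E,
  forall z, cabs z <= 1 ->
  [/\ forall x, F z (x - z ^+ (2 ^ m) *: iter (2 ^ m) B x) = x,
      {morph F z : x y / x - y},
      forall y, nrm (F z y) <= M * nrm y &
      forall w y, cabs w <= 1 ->
        nrm (F z y - F w y) <= M * cabs (z - w) * nrm y].
Proof.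
have [M M0 lowM] := resolvent_bound.
(* Dominates both the resolvent bound [M] and the Lipschitz constant [M * C * b * M]. *)
pose M' := M * (C + 1) * (b + 1) * (M + 1).
have MM' : M <= M'.
  have C1 : 1 <= C + 1 by rewrite lerDr.
  have b1 : 1 <= b + 1 by rewrite lerDr ltW.
  have M1 : 1 <= M + 1 by rewrite lerDr ltW.
  by rewrite /M' -2!mulrA (ler_peMr (ltW M0))// mulr_ege1 ?mulr_ege1.
have M'0 : 0 < M' := lt_le_trans M0 MM'.
exists M' => // m.
elim: m => [|m [F IH]].
  have /choice [F FP] : forall z, exists Q : E -> E, cabs z <= 1 ->
      (forall x, Q (x - z *: B x) = x) /\ (forall y, Q y - z *: B (Q y) = y).
    move=> z; have [/resolvent [Q [? [? ? _]]]|_] := boolP (cabs z <= 1).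
      by exists Q.
    by exists id.
  exists F => z z1; have [FK KF] := FP z z1.
  have Fle y : nrm (F z y) <= M * nrm y by rewrite -{2}(KF y); exact: lowM.
  have FB : {morph F z : u v / u - v}.
    by move=> u v; rewrite -[RHS]FK linearB scalerBr /= opprD addrACA -opprD !KF.
  split => //= [y|w y w1]; first by rewrite (le_trans (Fle y))// ler_wpM2r.
  have [_ KFw] := FP w w1.
  (* The resolvent identity, from which the Lipschitz estimate follows. *)
  have -> : F z y - F w y = F z ((z - w) *: B (F w y)).
    rewrite -[LHS]FK; congr (F z _).
    rewrite linearB scalerBr /= opprD addrACA -opprD KF -{1}(KFw y).
    by rewrite opprB scalerBl addrC addrA subrK.
  rewrite (le_trans (Fle _))//.
  rewrite (@le_trans _ _ (M * (C * cabs (z - w) * nrm (B (F w y)))))//.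
    by rewrite ler_pM2l.
  rewrite (@le_trans _ _ (M * (C * cabs (z - w) * (b * (M * nrm y)))))//.
    rewrite ler_pM2l// ler_wpM2l ?mulr_ge0 ?cabs_ge0//.
    rewrite (le_trans (nrmB _))// ler_pM2l//.
    by rewrite -{2}(KFw y); exact: lowM.
  have -> : M * (C * cabs (z - w) * (b * (M * nrm y))) =
    (M * C * b * M) * (cabs (z - w) * nrm y) by ring.
  rewrite -[X in _ <= X]mulrA ler_wpM2r ?mulr_ge0 ?cabs_ge0//.
  have [M00 b0] := (ltW M0, ltW b_gt0).
  by rewrite /M' !ler_pM ?mulr_ge0 ?lerDl.
have [w w1 wm] := @root_opp1 R (2 ^ m) (expn_gt0 2 m).
have cw z : cabs (w * z) = cabs z by rewrite cabsM w1 mul1r.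
(* With [Y = (z B) ^ (2 ^ m)], factor [1 - Y ^ 2] as [(1 - Y)(1 + Y)]: the two inverses send
   [x - Y (Y x)] to [x + Y x] and [x - Y x], whose average is [x]. *)
exists (fun z y => (2^-1)%:C%C *: (F z y + F (w * z) y)) => z z1.
have [Fz1 FzB Fz2 Fz3] := IH z z1.
have [Fw1 FwB Fw2 Fw3] := IH (w * z) (eq_ind_r (fun t => t <= 1) z1 (cw z)).
have h2 : `|2^-1 : R| = 2^-1 by rewrite ger0_norm ?invr_ge0.
split=> [x|u v|y|v y v1].
- set Y := fun x => z ^+ (2 ^ m) *: iter (2 ^ m) B x.
  have YY : z ^+ (2 ^ m.+1) *: iter (2 ^ m.+1) B x = Y (Y x).
    by rewrite expnS mul2n -addnn exprD iterD /Y iterZ scalerA.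
  have Y_add u v : Y (u + v) = Y u + Y v.
    by rewrite /Y -[u]scale1r iter_lin !scale1r scalerDr.
  have Y_opp u : Y (- u) = - Y u.
    by rewrite /Y -scaleN1r iterZ scalerA mulrC -scalerA scaleN1r.
  rewrite YY.
  have -> : x - Y (Y x) = (x + Y x) - Y (x + Y x).
    by rewrite Y_add opprD addrA addrK.
  rewrite (Fz1 (x + Y x)).
  have -> : (x + Y x) - Y (x + Y x) = (x - Y x) + Y (x - Y x).
    by rewrite !Y_add Y_opp opprD addrA addrK addrA subrK.
  have -> : (x - Y x) + Y (x - Y x) =
      (x - Y x) - (w * z) ^+ (2 ^ m) *: iter (2 ^ m) B (x - Y x).
    by rewrite exprMn wm mulN1r scaleNr opprK.
  rewrite Fw1 addrACA subrr addr0 -mulr2n -[x *+ 2]scaler_nat scalerA.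
  by rewrite fmorphV rmorph_nat mulVf ?scale1r// pnatr_eq0.
- by rewrite FzB FwB -scalerBr opprD addrACA.
- rewrite nrmR h2 ler_pdivrMl// (le_trans (nrmD _ _))//.
  by have := Fz2 y; have := Fw2 y; lra.
- rewrite -scalerBr nrmR h2 ler_pdivrMl// opprD addrACA (le_trans (nrmD _ _))//.
  have := Fz3 v y v1; have := Fw3 (w * v) y (eq_ind_r (fun t => t <= 1) v1 (cw v)).
  by rewrite -mulrBr cw; lra.
Qed.

Lemma squaring_contraction :
  exists m, forall x, nrm (iter (2 ^ m) B x) <= 2^-1 * nrm x.
Proof.
have [M M0 famM] := inverse_family.
pose S (s : R) := exists m, forall x,
  s ^+ (2 ^ m) * nrm (iter (2 ^ m) B x) <= 2^-1 * nrm x.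
(* The 8 makes each of the two errors below at most [nrm y / 8], so [nrm X] is at most a quarter of
   [nrm x + nrm X], hence at most a third of [nrm x]. *)
pose d := (8 * M)^-1.
have d0 : 0 < d by rewrite invr_gt0 mulr_gt0.
(* Further squarings improve the factor 1/2 to any prescribed [e]. *)
have small s e : 0 <= s -> 0 < e -> S s -> exists m, forall x,
    s ^+ (2 ^ m) * nrm (iter (2 ^ m) B x) <= e * nrm x.
  move=> s0 e0 [m Hm].
  have pow j x : s ^+ (2 ^ (m + j)) * nrm (iter (2 ^ (m + j)) B x) <=
      2^-1 ^+ (2 ^ j) * nrm x.
    elim: j x => [|j IH] x; first by rewrite addn0.
    rewrite addnS expnS mul2n -addnn exprD iterD -mulrA.
    rewrite (le_trans (ler_wpM2l (exprn_ge0 _ s0) (IH _)))//.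
    rewrite mulrCA [(2 ^ j.+1)%N]expnS mul2n -addnn exprD -mulrA.
    by rewrite ler_wpM2l ?exprn_ge0 ?invr_ge0.
  have [j je] : exists j, 2^-1 ^+ (2 ^ j) <= e.
    have [n ne] : exists n, e^-1 <= n%:R.
      by exists (Num.bound e^-1); rewrite ltW// archi_boundP// invr_ge0 ltW.
    exists n; rewrite exprVn invf_ple ?posrE ?exprn_gt0//.
    rewrite (le_trans ne)// -natrX ler_nat.
    by rewrite (leq_trans (ltnW (ltn_expl n (ltnSn 1))))// ltnW// ltn_expl.
  by exists (m + j)%N => x; rewrite (le_trans (pow j x))// ler_wpM2r.
have step s t : 0 <= s <= 1 -> 0 <= t <= 1 -> `|s - t| <= d -> S t -> S s.
  move=> /andP[s0 s1] /andP[t0 t1] std St.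
  have [m Hm] := small t (8 * M)^-1 t0 d0 St.
  exists m => x; have [F FP] := famM m.
  have cs : cabs s%:C%C <= 1 by rewrite cabs_real ger0_norm.
  have ct : cabs t%:C%C <= 1 by rewrite cabs_real ger0_norm.
  have [Fs1 _ _ Fs3] := FP _ cs; have [Ft1 FtB Ft2 _] := FP _ ct.
  set X := s%:C%C ^+ (2 ^ m) *: iter (2 ^ m) B x.
  have nX : nrm X = s ^+ (2 ^ m) * nrm (iter (2 ^ m) B x).
    by rewrite /X -rmorphXn nrmR ger0_norm// exprn_ge0.
  rewrite -nX; set y := x - X.
  have Fy : F s%:C%C y = x by exact: Fs1.
  pose Y := t%:C%C ^+ (2 ^ m) *: iter (2 ^ m) B y.
  have nY : nrm Y <= (8 * M)^-1 * nrm y.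
    by rewrite /Y -rmorphXn nrmR ger0_norm ?exprn_ge0.
  have Fty : nrm (F t%:C%C y - y) <= 8^-1 * nrm y.
    have := Ft1 y; rewrite FtB -/Y => e.
    have -> : F t%:C%C y - y = F t%:C%C Y by rewrite -{2}e opprB addrC subrK.
    rewrite (le_trans (Ft2 _))// (le_trans (ler_wpM2l (ltW M0) nY))//.
    by rewrite invfM mulrA mulrCA mulfV ?gt_eqF// mulr1.
  have Fsy : nrm (F s%:C%C y - F t%:C%C y) <= 8^-1 * nrm y.
    rewrite (le_trans (Fs3 _ _ ct))// ler_wpM2r// -rmorphB cabs_real.
    by rewrite -ler_pdivlMl// (le_trans std)// /d invfM mulrC.
  (* The first difference is small by the Lipschitz bound, the second because it is the image of [Y]
     under [F t]. *)
  have xy : X = (F s%:C%C y - F t%:C%C y) + (F t%:C%C y - y).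
    by rewrite addrA subrK Fy /y opprB addrC subrK.
  have h1 := nrmD (F s%:C%C y - F t%:C%C y) (F t%:C%C y - y).
  have h2 := nrmD x (- X); rewrite nrmN in h2.
  rewrite -xy in h1; have := nrm_ge0 X; have := nrm_ge0 x; rewrite -/y in h2; lra.
(* A chain of [n] steps of length [1 / n] leads from 0, where the claim is trivial, to 1. *)
have [n n0 nd] : exists2 n, (0 < n)%N & n%:R^-1 <= d.
  exists (Num.bound d^-1).+1 => //; rewrite invf_ple ?posrE// ltW//.
  rewrite (lt_trans (archi_boundP _))// ?ltr_nat// invr_ge0 ltW//.
have : S (n%:R / n%:R).
  have : (n <= n)%N by [].
  elim: {1 3}n => [_|j IH jn].
    by exists 0%N => x; rewrite mul0r expr0n/= mul0r mulr_ge0 ?invr_ge0.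
  apply: (step _ (j%:R / n%:R)); last exact: IH (ltnW jn).
  - by rewrite divr_ge0//= ler_pdivrMr ?ltr0n// mul1r ler_nat.
  - by rewrite divr_ge0//= ler_pdivrMr ?ltr0n// mul1r ler_nat ltnW.
  - by rewrite -mulrBl -natrB ?subSnn// mul1r ger0_norm ?invr_ge0.
rewrite divff ?pnatr_eq0 -?lt0n// => -[m Hm]; exists m => x.
by have := Hm x; rewrite expr1n mul1r.
Qed.

End SquaringContraction.

(** * Real and complex scalars treated together *)

Section Scalars.
Context {R : realType} {k : field_kind}.
Local Notation K := (scalarF R k).

(** Norms are values of [toF], so estimates for both kinds of scalars can be carried out in [R]. *)
Definition toF : R -> K :=
  match k with RealScalars => id | ComplexScalars => fun x => x%:C%C end.

Lemma reF_toF t : reF (toF t) = t.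
Proof. by rewrite /reF /toF; case: k. Qed.

Lemma reFD (a b : K) : reF (a + b) = reF a + reF b.
Proof. by rewrite /reF; case: k a b => // -[a c] [b d]. Qed.

Lemma reFN (a : K) : reF (- a) = - reF a.
Proof. by rewrite /reF; case: k a => // -[a b]. Qed.

Lemma reF_conj (a : K) : reF (conjF a) = reF a.
Proof. by rewrite /reF /conjF; case: k a => //= -[a b]. Qed.

Lemma toFD s t : toF (s + t) = toF s + toF t.
Proof. by rewrite /toF; case: k => //; exact: rmorphD. Qed.

Lemma toFM s t : toF (s * t) = toF s * toF t.
Proof. by rewrite /toF; case: k => //; exact: rmorphM. Qed.

Lemma toFX s n : toF (s ^+ n) = toF s ^+ n.
Proof. by rewrite /toF; case: k => //; exact: rmorphXn. Qed.

Lemma toFN s : toF (- s) = - toF s.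
Proof. by rewrite /toF; case: k => //; exact: rmorphN. Qed.

Lemma toF1 : toF 1 = 1.
Proof. by rewrite /toF; case: k. Qed.

Lemma toF0 : toF 0 = 0.
Proof. by rewrite /toF; case: k. Qed.

Lemma toF_inj : injective toF.
Proof. by move=> s t /(congr1 reF); rewrite !reF_toF. Qed.

Lemma toF_lt s t : (toF s < toF t) = (s < t).
Proof. by rewrite /toF; case: k => //; exact: ltcR. Qed.

Lemma toF_le s t : (toF s <= toF t) = (s <= t).
Proof. by rewrite /toF; case: k => //; exact: lecR. Qed.

Lemma toF_reF (a : K) : 0 <= a -> a = toF (reF a).
Proof.
rewrite /toF /reF; case: k a => // a a0.
by rewrite RRe_real// ger0_real.
Qed.

Lemma conjF_toF t : conjF (toF t) = toF t.
Proof. by rewrite /conjF /toF; case: k => //; exact: conjc_real. Qed.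

Section Norm.
Variable V : normedZmodType K.
Implicit Types x y : V.

Lemma norm_rnorm x : `|x| = toF (rnorm x).
Proof. exact/toF_reF/normr_ge0. Qed.

Lemma rnorm_ge0 x : 0 <= rnorm x.
Proof. by rewrite -toF_le toF0 -norm_rnorm. Qed.

Lemma rnormD x y : rnorm (x + y) <= rnorm x + rnorm y.
Proof. by rewrite -toF_le toFD -!norm_rnorm ler_normD. Qed.

Lemma rnormN x : rnorm (- x) = rnorm x.
Proof. by rewrite /rnorm normrN. Qed.

Lemma rnorm0 : rnorm (0 : V) = 0.
Proof. by apply: toF_inj; rewrite -norm_rnorm normr0 toF0. Qed.

Lemma rnorm0_eq0 x : rnorm x = 0 -> x = 0.
Proof. by move=> x0; apply/eqP; rewrite -normr_eq0 norm_rnorm x0 toF0. Qed.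

End Norm.

Lemma rnormZ (V : normedModType K) (a : K) (x : V) :
  rnorm (a *: x) = rnorm a * rnorm x.
Proof. by apply: toF_inj; rewrite toFM -!norm_rnorm normrZ. Qed.

Lemma rnorm_toF t : rnorm (toF t) = `|t|.
Proof. by rewrite /rnorm /reF /toF; case: k => //; exact: cabs_real. Qed.

Lemma rnormM (a b : K) : rnorm (a * b) = rnorm a * rnorm b.
Proof. by apply: toF_inj; rewrite toFM -!norm_rnorm normrM. Qed.

Lemma mul_conjF (a : K) : a * conjF a = toF (rnorm a ^+ 2).
Proof.
rewrite toFX -norm_rnorm /conjF; case: k a => a; last by rewrite normCK.
by rewrite real_normK ?num_real.
Qed.

Lemma scalar_parallelogram (a b : K) :
  rnorm (a + b) ^+ 2 + rnorm (a - b) ^+ 2 = 2 * rnorm a ^+ 2 + 2 * rnorm b ^+ 2.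
Proof.
apply: toF_inj; rewrite !mulr_natl !mulr2n !toFD -!mul_conjF rmorphB rmorphD/=.
by ring.
Qed.

End Scalars.

(** * Completeness and minimisation of quadratic functionals *)

Section Completeness.
Context {R : realType} {k : field_kind}.
Local Notation K := (scalarF R k).

Lemma pos_toF (e : K) : 0 < e -> exists2 d, 0 < d & e = toF d.
Proof.
move=> e0; have eE := toF_reF (ltW e0).
by exists (reF e) => //; rewrite -(@toF_lt R k) toF0 -eE.
Qed.

Lemma continuous_rnorm_bound (V W : normedModType K) (A : {linear V -> W}) :
  continuous A -> exists2 b, 0 < b & forall x, rnorm (A x) <= b * rnorm x.
Proof.
move=> /linear_bounded_continuous/linear_boundedP/pinfty_ex_gt0[c c0 Ac].
have [b b0 cb] := pos_toF c0; exists b => // x.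
by rewrite -(@toF_le R k) toFM -!norm_rnorm -cb.
Qed.

Variable V : completeNormedModType K.

Lemma rnorm_complete (W : set V) (u : nat -> V) : closed W ->
  (forall n, W (u n)) ->
  (forall e, 0 < e -> exists N, forall m n, (N <= m)%N -> (N <= n)%N ->
     rnorm (u m - u n) < e) ->
  exists2 l, W l & forall e, 0 < e -> exists N, forall n, (N <= n)%N ->
    rnorm (l - u n) < e.
Proof.
move=> Wcl Wu uC.
have ucvg : cvgn u.
  apply: cauchy_cvg; apply: cauchy_exP => _ /pos_toF[e e0 ->].
  have [N HN] := uC _ e0; exists (u N); exists N => //= n Nn.
  by rewrite -ball_normE /ball_/= norm_rnorm toF_lt; exact: HN.
exists (limn u); first by apply: (closed_cvg W) ucvg => //; exact: nearW.
move=> e e0.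
have /cvgrPdist_lt/(_ (toF e)) := ucvg; rewrite -(@toF0 R k) toF_lt => /(_ e0)[N _ HN].
by exists N => n Nn; rewrite -(@toF_lt R k) -norm_rnorm; exact: HN.
Unshelve. all: by end_near. Qed.

(* The midpoint identity makes minimising sequences of [J] Cauchy, and forces
   [J] to be quadratic around its minimum. *)
Lemma quadratic_minimum (W : set V) (J q : V -> R) (alpha beta : R) :
  closed_subspace W -> 0 < alpha ->
  (forall v, W v -> 0 <= J v) ->
  (forall h, W h -> alpha * rnorm h ^+ 2 <= q h <= beta * rnorm h ^+ 2) ->
  (forall t h, W h -> q (toF t *: h) = t ^+ 2 * q h) ->
  (forall v h, W v -> W h -> J (v + h) + J (v - h) = 2 * J v + 2 * q h) ->
  (forall e v h, 0 < e -> W v -> W h ->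
     J (v + h) <= (1 + e) * J v + (1 + e^-1) * q h) ->
  exists2 v, W v & forall h, W h -> J (v + h) = J v + q h.
Proof.
move=> [Wcl W0 WP] a0 J0 qb qZ Jpar Jyoung.
have WZ a v : W v -> W (a *: v) by move=> Wv; rewrite -[_ *: _]addr0; exact: WP.
have WD v h : W v -> W h -> W (v + h).
  by move=> Wv Wh; rewrite -[v]scale1r; exact: WP.
have WN v : W v -> W (- v) by rewrite -scaleN1r; exact: WZ.
pose d := inf (J @` W).
have Jinf : has_inf (J @` W).
  split; first by exists (J 0); exists 0.
  by exists 0 => _ [v Wv <-]; exact: J0.
have dJ v : W v -> d <= J v by move=> Wv; apply: inf_lbound; [case: Jinf|exists v].
have /choice [u uP] : forall n : nat, exists v, W v /\ J v < d + n.+1%:R^-1.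
  move=> n; have n0 : 0 < n.+1%:R^-1 :> R by rewrite invr_gt0.
  have [_ [v Wv <-] Jv] := inf_adherent n0 Jinf.
  by exists v.
have Wu n : W (u n) by case: (uP n).
have b0 h : W h -> 0 <= q h.
  by move=> Wh; have /andP[] := qb h Wh; have := sqr_ge0 (rnorm h); nra.
have half (v : V) : v = toF 2^-1 *: v + toF 2^-1 *: v.
  rewrite -scalerDl -toFD -[LHS]scale1r -(@toF1 R k).
  by congr (toF _ *: _); lra.
have uC e : 0 < e -> exists N, forall m n, (N <= m)%N -> (N <= n)%N ->
    rnorm (u m - u n) < e.
  move=> e0.
  pose N := Num.bound (4 / (alpha * e ^+ 2)).
  have c0 : 0 < alpha * e ^+ 2 by rewrite mulr_gt0// exprn_gt0.
  have HN m : (N <= m)%N -> m.+1%:R^-1 < alpha * e ^+ 2 / 4.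
    move=> Nm; rewrite invf_plt ?posrE ?divr_gt0// invf_div.
    have D0 : 0 <= 4 / (alpha * e ^+ 2) by rewrite divr_ge0// ltW.
    by rewrite (lt_le_trans (archi_boundP D0))// ler_nat leqW.
  exists N => m n Nm Nn.
  (* Midpoint and half-difference of two almost-minimisers: as [J c] is at least [d], the
     parallelogram law forces [q h] below [alpha * e ^+ 2 / 4]. *)
  pose c := toF 2^-1 *: (u m + u n); pose h := toF 2^-1 *: (u m - u n).
  have Wc : W c by apply/WZ/WD.
  have Wh : W h by apply/WZ/WD => //; exact/WN.
  have cph : c + h = u m.
    by rewrite /c /h -scalerDr addrACA subrr addr0 scalerDr -half.
  have cmh : c - h = u n.
    by rewrite /c /h -scalerBr opprB [u m + _]addrC addrACA subrr addr0 scalerDr -half.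
  have := Jpar c h Wc Wh; rewrite cph cmh.
  have := dJ _ Wc; have [_ um] := uP m; have [_ un] := uP n.
  have [lm ln] := (HN m Nm, HN n Nn).
  have /andP[qh _] := qb h Wh.
  have hn : rnorm h = 2^-1 * rnorm (u m - u n).
    by rewrite rnormZ rnorm_toF ger0_norm// invr_ge0.
  rewrite hn in qh => dc Je.
  rewrite -ltr_sqr ?nnegrE ?rnorm_ge0 ?(ltW e0)// -(ltr_pM2l a0).
  have r4 r : alpha * (2^-1 * r) ^+ 2 = alpha * r ^+ 2 / 4 by field.
  rewrite r4 in qh.
  rewrite -(ltrD2l d) in lm; rewrite -(ltrD2l d) in ln.
  move: qh Je dc (lt_trans um lm) (lt_trans un ln).
  move: (alpha * e ^+ 2) (alpha * _ ^+ 2) (J c) (q h) (J (u m)) (J (u n)) => *; lra.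
have [v Wv vlim] := rnorm_complete Wcl Wu uC.
have Jv : J v <= d.
  (* Young's inequality stands in for continuity of [J]; a distance below [e ^+ 2] from [u n] to [v]
     beats the factor [e^-1]. *)
  have Je e : 0 < e -> J v <= (1 + e) * (d + e) + (1 + e^-1) * (`|beta| * e ^+ 4).
    move=> e0; have [N HN] := vlim _ (exprn_gt0 2 e0).
    have [M HM] : exists M : nat, forall m, (M <= m)%N -> m.+1%:R^-1 <= e.
      exists (Num.bound e^-1) => m mM; rewrite invf_ple ?posrE// ltW//.
      have D0 : 0 <= e^-1 by rewrite invr_ge0 ltW.
      by rewrite (lt_le_trans (archi_boundP D0))// ler_nat leqW.
    pose n := maxn N M.
    have Wn : W (v - u n) by apply: WD => //; exact: WN.
    have vE : v = u n + (v - u n) by rewrite addrC subrK.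
    rewrite {1}vE (le_trans (Jyoung e _ _ e0 (Wu n) Wn))//.
    apply: lerD.
      rewrite ler_wpM2l ?addr_ge0 ?(ltW e0)//; have [_ un] := uP n.
      rewrite ltW// (lt_le_trans un)// lerD2l.
      by apply: HM; rewrite leq_maxr.
    rewrite ler_wpM2l ?addr_ge0 ?invr_ge0 ?(ltW e0)//.
    have /andP[_ qh] := qb _ Wn; apply: (le_trans qh).
    rewrite (le_trans (ler_wpM2r (sqr_ge0 _) (ler_norm _)))// ler_wpM2l//.
    have -> : e ^+ 4 = (e ^+ 2) ^+ 2 by rewrite -exprM.
    by rewrite ler_sqr ?nnegrE ?rnorm_ge0 ?sqr_ge0// ltW// HN// leq_maxl.
  have d0 : 0 <= d.
    by apply: lb_le_inf; [case: Jinf|move=> _ [w Ww <-]; exact: J0].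
  rewrite leNgt; apply/negP => dJv.
  (* As [e] is at most 1, the bound in [Je] exceeds [d] by at most [e] times [d + 2 + 2 |beta|],
     that is, by at most half of [J v - d]. *)
  pose e := Num.min 1 ((J v - d) / (2 * (d + 2 + 2 * `|beta|))).
  have B0 := normr_ge0 beta.
  have D0 : 0 < 2 * (d + 2 + 2 * `|beta|) by lra.
  have e0 : 0 < e by rewrite lt_min ltr01 divr_gt0// subr_gt0.
  have e1 : e <= 1 by rewrite ge_min lexx.
  have e2 : e * (2 * (d + 2 + 2 * `|beta|)) <= J v - d.
    by rewrite -ler_pdivlMr// ge_min lexx orbT.
  have := Je e e0.
  have -> : (1 + e^-1) * (`|beta| * e ^+ 4) = `|beta| * (e ^+ 4 + e ^+ 3).
    by field; rewrite gt_eqF.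
  have e4 : e ^+ 4 <= e by rewrite -[leRHS]expr1 ler_wiXn2l// ltW.
  have e3 : e ^+ 3 <= e by rewrite -[leRHS]expr1 ler_wiXn2l// ltW.
  nra.
have pos h : W h -> J v + q h <= J (v + h).
  move=> Wh.
  (* The deviation of [J] from its quadratic part along [h]. By the parallelogram law it halves when
     [n] grows by 1, while minimality bounds it below by [- q h / 4 ^ n]; hence [g 0] cannot be
     negative. *)
  pose g n := J (v + toF (2^-1 ^+ n) *: h) - J v - (2^-1 ^+ n) ^+ 2 * q h.
  have gS n : g n = 2 * g n.+1.
    pose s : R := 2^-1 ^+ n.+1.
    have W1 : W (toF s *: h) by exact: WZ.
    have := Jpar _ _ (WD _ _ Wv W1) W1; rewrite -addrA addrK.
    rewrite -scalerDl -toFD.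
    have ss : s + s = 2^-1 ^+ n by rewrite /s exprS; lra.
    have -> : (g n = J (v + toF (2^-1 ^+ n) *: h) - J v - (s + s) ^+ 2 * q h).
      by rewrite ss.
    by rewrite -ss qZ// /g -/s; lra.
  have g0 n : g 0%N = 2 ^+ n * g n.
    elim: n => [|n IH]; first by rewrite expr0 mul1r.
    by rewrite IH gS exprSr mulrA.
  rewrite leNgt; apply/negP => Jlt.
  have q0 := b0 h Wh.
  pose n := Num.bound (q h / (J v + q h - J (v + h))).
  have D0 : 0 < J v + q h - J (v + h) by rewrite subr_gt0.
  have nq : q h < n%:R * (J v + q h - J (v + h)).
    by rewrite -ltr_pdivrMr// archi_boundP// divr_ge0// ltW.
  have n2 : n%:R <= 2 ^+ n :> R by rewrite -natrX ler_nat ltnW// ltn_expl.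
  have := dJ _ (WD _ _ Wv (WZ (toF (2^-1 ^+ n)) _ Wh)).
  have E0 := g0 n; have : 2 ^+ n * 2^-1 ^+ n = 1 :> R.
    by rewrite -exprMn mulfV// expr1n.
  move: E0; rewrite {1}/g expr0 toF1 scale1r expr1n mul1r /g.
  set s := 2^-1 ^+ n; set p := 2 ^+ n in n2 *.
  have p0 : 0 < p by rewrite exprn_gt0.
  move=> E0 ps dJs.
  have : p * (J v + q h - J (v + h)) <= q h.
    have -> : J v + q h - J (v + h) = - (p * (J (v + toF s *: h) - J v - s ^+ 2 * q h)).
      by rewrite -E0; ring.
    have -> : p * - (p * (J (v + toF s *: h) - J v - s ^+ 2 * q h)) =
       - (p ^+ 2 * (J (v + toF s *: h) - J v)) + (p * s) ^+ 2 * q h by ring.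
    rewrite ps expr1n mul1r gerDr oppr_le0 mulr_ge0 ?sqr_ge0//.
    by rewrite subr_ge0 (le_trans Jv).
  by apply/negP; rewrite -ltNge (lt_le_trans nq)// ler_wpM2r// ltW.
exists v => // h Wh.
(* The lower bounds for [h] and [- h] add up to the parallelogram identity, so both are
   equalities. *)
have := Jpar v h Wv Wh; have := pos h Wh; have := pos (- h) (WN _ Wh).
have -> : q (- h) = q h.
  have := qZ (-1) h Wh; rewrite toFN toF1 scaleN1r => ->.
  by rewrite sqrrN expr1n mul1r.
by lra.
Qed.

End Completeness.

(** * Hilbert space geometry: Cauchy-Schwarz, projections and adjoints *)

Section HilbertSpace.
Context {R : realType} {k : field_kind}.
Local Notation K := (scalarF R k).
Variables (H : completeNormedModType K) (dot : {dot H for conjF}).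
Hypothesis dotN : hilbert_norm dot.
Implicit Types x y z : H.

Lemma dotC x y : dot x y = conjF (dot y x).
Proof. by have := @hermitian_subproof _ _ _ _ dot x y; rewrite expr0 mul1r. Qed.

Lemma dot0l z : dot 0 z = 0.
Proof. exact: linear0l. Qed.

Lemma dot0r z : dot z 0 = 0.
Proof. by rewrite dotC dot0l rmorph0. Qed.

Lemma dotDl x y z : dot (x + y) z = dot x z + dot y z.
Proof. exact: linearDl. Qed.

Lemma dotZl (a : K) x z : dot (a *: x) z = a * dot x z.
Proof. exact: linearZl_LR. Qed.

Lemma dotBl x y z : dot (x - y) z = dot x z - dot y z.
Proof. exact: linearBl. Qed.

Lemma dotDr x y z : dot z (x + y) = dot z x + dot z y.
Proof. by rewrite dotC dotDl rmorphD /= -!dotC. Qed.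

Lemma dotBr x y z : dot z (x - y) = dot z x - dot z y.
Proof. by rewrite dotC dotBl rmorphB /= -!dotC. Qed.

Lemma dotZr (a : K) x z : dot z (a *: x) = conjF a * dot z x.
Proof. by rewrite dotC dotZl rmorphM /= -dotC. Qed.

Lemma dot_rnorm x : dot x x = toF (rnorm x ^+ 2).
Proof. by rewrite dotN norm_rnorm toFX. Qed.

Lemma sqr_rnormD x y :
  rnorm (x + y) ^+ 2 = rnorm x ^+ 2 + 2 * reF (dot x y) + rnorm y ^+ 2.
Proof.
rewrite -[LHS](@reF_toF R k) -dot_rnorm dotDl !dotDr !reFD !dot_rnorm !reF_toF.
by rewrite (dotC y x) reF_conj; lra.
Qed.

Lemma hilbert_parallelogram x y :
  rnorm (x + y) ^+ 2 + rnorm (x - y) ^+ 2 = 2 * rnorm x ^+ 2 + 2 * rnorm y ^+ 2.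
Proof.
have dotNr : dot x (- y) = - dot x y by exact: linearNr.
by rewrite !sqr_rnormD dotNr reFN rnormN; lra.
Qed.

Lemma dot_CauchySchwarz x y : rnorm (dot x y) <= rnorm x * rnorm y.
Proof.
have [->|y0] := eqVneq y 0.
  by rewrite dot0r !rnorm0 mulr0.
rewrite -ler_sqr ?nnegrE ?mulr_ge0 ?rnorm_ge0// -subr_ge0.
have yn : 0 < rnorm y ^+ 2.
  rewrite exprn_gt0// lt_def rnorm_ge0 andbT; apply: contra y0 => /eqP y0.
  by apply/eqP; exact: rnorm0_eq0.
rewrite -(pmulr_rge0 _ yn); set s := rnorm y ^+ 2.
have := sqr_ge0 (rnorm (toF s *: x - dot x y *: y)).
congr (0 <= _); apply: (@toF_inj R k); rewrite -dot_rnorm.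
transitivity (toF s * (toF s * toF (rnorm x ^+ 2) - toF (rnorm (dot x y) ^+ 2))
  : scalarF R k).
  rewrite dotBl !dotBr !dotZl !dotZr !dot_rnorm -/s (dotC y x) conjF_toF.
  by rewrite -mul_conjF; ring.
rewrite -[toF s * toF (_ ^+ 2)]toFM -toFN -toFD -toFM.
by rewrite exprMn [rnorm x ^+ 2 * _]mulrC.
Qed.

Lemma closed_rnorm (W : set H) :
  (forall l, (forall e, 0 < e -> exists2 x, W x & rnorm (l - x) < e) -> W l) ->
  closed W.
Proof.
move=> HW l lW; apply: HW => e e0.
have [|x [Wx]] := lW (ball l (toF e)).
  by apply: nbhsx_ballx; rewrite -(@toF0 R k) toF_lt.
rewrite -ball_normE /ball_ /= norm_rnorm toF_lt => lx.
by exists x.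
Qed.

Lemma young_sqr (e a b : R) : 0 < e ->
  (a + b) ^+ 2 <= (1 + e) * a ^+ 2 + (1 + e^-1) * b ^+ 2.
Proof.
move=> e0; rewrite -subr_ge0.
have -> : (1 + e) * a ^+ 2 + (1 + e^-1) * b ^+ 2 - (a + b) ^+ 2 =
   e^-1 * (e * a - b) ^+ 2 by field; rewrite gt_eqF.
by rewrite mulr_ge0 ?sqr_ge0// invr_ge0 ltW.
Qed.

Lemma sqr_rnorm_young (V : normedZmodType K) e (x y : V) : 0 < e ->
  rnorm (x + y) ^+ 2 <= (1 + e) * rnorm x ^+ 2 + (1 + e^-1) * rnorm y ^+ 2.
Proof.
move=> e0; apply: le_trans (young_sqr _ _ e0).
by rewrite ler_sqr ?nnegrE ?addr_ge0 ?rnorm_ge0 ?rnormD.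
Qed.

Section Projection.
Variable W : set H.
Hypothesis Wsub : closed_subspace W.

Let WZ (a : K) x : W x -> W (a *: x).
Proof. by case: Wsub => _ W0 WP Wx; rewrite -[_ *: _]addr0; exact: WP. Qed.

(** [orth_proj] is a choice with default 0, so a witness is needed: the minimiser of the squared
    distance from [f] to [W]. *)
Lemma orth_projP f :
  W (orth_proj dot W f) /\ forall v, W v -> dot (f - orth_proj dot W f) v = 0.
Proof.
suff [p Wp] : exists p, W p /\ forall v, W v -> dot (f - p) v = 0.
  have := @xgetPex _ 0 [set p | W p /\ forall v, W v -> dot (f - p) v = 0].
  by apply; exists p.
have [v Wv vmin] : exists2 v, W v & forall h, W h ->
    rnorm (f - (v + h)) ^+ 2 = rnorm (f - v) ^+ 2 + rnorm h ^+ 2.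
  apply: (@quadratic_minimum _ _ _ W (fun v => rnorm (f - v) ^+ 2)
    (fun h => rnorm h ^+ 2) 1 1) => //.
  - by move=> v _; exact: sqr_ge0.
  - by move=> h _; rewrite !mul1r lexx.
  - by move=> t h _; rewrite rnormZ rnorm_toF exprMn real_normK ?num_real.
  - move=> v h _ _; rewrite -hilbert_parallelogram [RHS]addrC opprD addrA.
    by congr (_ + rnorm _ ^+ 2); rewrite opprB addrCA addrC.
  - move=> e v h e0 _ _; rewrite opprD addrA -(rnormN h).
    exact: sqr_rnorm_young.
have re0 h : W h -> reF (dot (f - v) h) = 0.
  move=> Wh; have := vmin _ (WZ (-1) Wh).
  rewrite scaleN1r opprD opprK addrA (sqr_rnormD (f - v)) (rnormN h).
  by lra.
exists v; split => // h Wh; apply/rnorm0_eq0/eqP; rewrite -sqrf_eq0.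
apply/eqP/(@toF_inj R k); rewrite toF0 -mul_conjF mulrC.
rewrite -dotZr.
(* Scaling [h] by this inner product turns it into its squared modulus, so vanishing real parts
   suffice for both kinds of scalars. *)
have := re0 _ (WZ (dot (f - v) h) Wh).
by rewrite dotZr mulrC mul_conjF reF_toF => ->; rewrite toF0.
Qed.

Lemma dot_orth_proj w f : W w -> dot w (orth_proj dot W f) = dot w f.
Proof.
move=> Ww; have [_ /(_ w Ww) fw] := orth_projP f.
apply/eqP; rewrite eq_sym -subr_eq0 -dotBr dotC fw.
by rewrite rmorph0.
Qed.

End Projection.

(** Riesz representation of the functional sending [x] to [dot (A x) y]: its kernel is a closed
    subspace, and a vector orthogonal to the kernel, suitably scaled, represents it. *)
Lemma adjointP (A : {linear H -> H}) b x y :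
  0 < b -> (forall x, rnorm (A x) <= b * rnorm x) ->
  dot (A x) y = dot x (adjoint dot A y).
Proof.
move=> b0 Ab.
suff [z zP] : exists z, forall x, dot (A x) y = dot x z.
  have := @xgetPex _ 0 [set z | forall x, dot (A x) y = dot x z].
  by apply; exists z.
pose W : set H := [set x | dot (A x) y = 0].
have Wsub : closed_subspace W.
  split.
  - apply: closed_rnorm => l lW; apply: rnorm0_eq0.
    apply/eqP; rewrite eq_le rnorm_ge0 andbT.
    apply/ler_addgt0Pl => e e0; rewrite addr0.
    have c0 : 0 < b * (rnorm y + 1).
      by rewrite mulr_gt0// ltr_wpDl// rnorm_ge0.
    have [v Wv lv] := lW (e / (b * (rnorm y + 1))) (divr_gt0 e0 c0).
    have -> : dot (A l) y = dot (A (l - v)) y.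
      by rewrite linearB dotBl (Wv : dot _ _ = 0) subr0.
    rewrite (le_trans (dot_CauchySchwarz _ _))//.
    rewrite (le_trans (ler_pM _ _ (Ab _) _ : _ <= _ * (rnorm y + 1)))//.
    + exact: rnorm_ge0.
    + exact: rnorm_ge0.
    + by rewrite lerDl.
    by move: lv; rewrite ltr_pdivlMr// => /ltW; rewrite mulrCA mulrA.
  - by rewrite /W /= linear0 dot0l.
  - move=> a u v Wu Wv; rewrite /W /= linearP dotDl dotZl.
    by rewrite (Wu : dot _ _ = 0) (Wv : dot _ _ = 0) mulr0 addr0.
have [[x0 Ax0]|A0] := pselect (exists x0, dot (A x0) y != 0); last first.
  exists 0 => u; rewrite dot0r; apply/eqP.
  by apply: contrapT => /negP Au; apply: A0; exists u.
have [WP PW] := orth_projP Wsub x0.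
set D := x0 - orth_proj dot W x0 in PW.
set p := dot (A D) y.
have p0 : p != 0.
  by rewrite /p linearB dotBl (WP : dot _ _ = 0) subr0.
have D0 : dot D D != 0.
  apply: contra p0; rewrite dot_rnorm => /eqP; rewrite -(@toF0 R k) => /toF_inj.
  move=> /eqP; rewrite sqrf_eq0 => /eqP/rnorm0_eq0 DE.
  by rewrite /p DE linear0 dot0l toF0 eqxx.
exists (conjF (p / dot D D) *: D) => u.
have Wu : W (u - (dot (A u) y / p) *: D).
  by rewrite /W /= linearB linearZ /= dotBl dotZl -/p divfK// subrr.
have := PW _ Wu; rewrite dotC => /(congr1 conjF); rewrite conjFK rmorph0.
rewrite dotBl dotZl => /eqP; rewrite subr_eq0 => /eqP uD.
by rewrite dotZr conjFK uD mulrA [p / _ * _]mulrC mulrA !divfK.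
Qed.

End HilbertSpace.

(** * Square-summable families *)

Section SquareSummable.
Context {R : realType} {k : field_kind} {J : choiceType}.
Local Notation K := (scalarF R k).
Implicit Types (a b z : J -> K) (c : K).

Definition sqsum z : \bar R := (\esum_(j in [set: J]) (rnorm (z j) ^+ 2)%:E)%E.

(** An infinite sum becomes 0 under [fine], hence the [l2] side conditions below. *)
Definition sq z : R := fine (sqsum z).

Definition l2 z := (sqsum z < +oo)%E.

(** For a positive factor one inequality holds by comparing finite sums; applied to the inverse
    factor, it gives the other. *)
Lemma ge0_esumZl (s : R) (u : J -> \bar R) : 0 <= s ->
  (forall j, (0 <= u j)%E) ->
  (\esum_(j in [set: J]) (s%:E * u j) = s%:E * \esum_(j in [set: J]) u j)%E.
Proof.
move=> s0 u0.
have le r (v : J -> \bar R) : 0 < r -> (forall j, (0 <= v j)%E) ->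
    (\esum_(j in [set: J]) (r%:E * v j) <= r%:E * \esum_(j in [set: J]) v j)%E.
  move=> r0 v0; apply: ge_ereal_sup => _ [X XJ <-].
  rewrite -ge0_mule_fsumr// lee_wpmul2l ?lee_fin ?(ltW r0)//.
  by apply: ereal_sup_ubound; exists X.
move: s0; rewrite le_eqVlt => /predU1P[<-|s0].
  by rewrite mul0e; apply: esum1 => j _; rewrite mul0e.
apply/eqP; rewrite eq_le le//= -lee_pdivlMl//.
have su0 j : (0 <= s%:E * u j)%E by rewrite mule_ge0// lee_fin ltW.
rewrite -[leLHS](@eq_esum _ _ _ (fun j => (s^-1)%:E * (s%:E * u j))%E).
  by rewrite le ?invr_gt0.
by move=> j _; rewrite muleA -EFinM mulVf ?gt_eqF// mul1e.
Qed.

Lemma sqsum_ge0 z : (0 <= sqsum z)%E.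
Proof. by apply: esum_ge0 => j _; rewrite lee_fin sqr_ge0. Qed.

Lemma sq_ge0 z : 0 <= sq z.
Proof. exact/fine_ge0/sqsum_ge0. Qed.

Lemma sqE z : l2 z -> sqsum z = (sq z)%:E.
Proof. by move=> z2; rewrite /sq fineK// ge0_fin_numE// sqsum_ge0. Qed.

Lemma sqsum_le_l2 z s : (sqsum z <= s%:E)%E -> l2 z /\ sq z <= s.
Proof.
move=> zs; have z2 : l2 z by exact: le_lt_trans zs (ltry _).
by split=> //; rewrite -lee_fin -sqE.
Qed.

Lemma sqsumZ c z : sqsum (fun j => c * z j) = ((rnorm c ^+ 2)%:E * sqsum z)%E.
Proof.
rewrite -ge0_esumZl ?sqr_ge0//; last by move=> j; rewrite lee_fin sqr_ge0.
by apply: eq_esum => j _; rewrite rnormM exprMn.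
Qed.

Lemma sqsum_parallelogram a b :
  (sqsum (a + b)%R + sqsum (a - b)%R = 2%:E * sqsum a + 2%:E * sqsum b)%E.
Proof.
rewrite /sqsum -!ge0_esumZl -?esumD//.
  by apply: eq_esum => j _; rewrite -!EFinD; congr EFin; exact: scalar_parallelogram.
all: by move=> *; rewrite ?mule_ge0 ?lee_fin ?sqr_ge0.
Qed.

(** The parallelogram identity in the extended reals takes the place of Minkowski's inequality. *)
Lemma l2D a b : l2 a -> l2 b -> l2 (a + b).
Proof.
move=> a2 b2; rewrite /l2 (@le_lt_trans _ _ (sqsum (a + b)%R + sqsum (a - b)%R)%E)//.
  by rewrite leeDl// sqsum_ge0.
by rewrite sqsum_parallelogram !sqE// -!EFinM -EFinD ltry.
Qed.

Lemma l2Z c z : l2 z -> l2 (fun j => c * z j).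
Proof. by move=> z2; rewrite /l2 sqsumZ sqE// -EFinM ltry. Qed.

Lemma sqZ c z : l2 z -> sq (fun j => c * z j) = rnorm c ^+ 2 * sq z.
Proof. by move=> z2; rewrite /sq sqsumZ sqE. Qed.

Lemma oppr_fct z : - z = (fun j => -1 * z j).
Proof. by apply/funext => j; rewrite mulN1r. Qed.

Lemma l2N z : l2 z -> l2 (- z).
Proof. by move=> z2; rewrite oppr_fct; exact: l2Z. Qed.

Lemma sqN z : sq (- z) = sq z.
Proof.
congr fine; apply: eq_esum => j _.
by rewrite -[(- z) j]/(- z j) rnormN.
Qed.

Lemma sq_parallelogram a b : l2 a -> l2 b ->
  sq (a + b) + sq (a - b) = 2 * sq a + 2 * sq b.
Proof.
move=> a2 b2; have := sqsum_parallelogram a b.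
by rewrite !sqE ?l2D ?l2N// -!EFinM -!EFinD => -[].
Qed.

Lemma sqsum_young (e : R) a b : 0 < e ->
  (sqsum (a + b)%R <= (1 + e)%:E * sqsum a + (1 + e^-1)%:E * sqsum b)%E.
Proof.
move=> e0; have e1 : 0 <= 1 + e by rewrite addr_ge0 ?ltW.
have e2 : 0 <= 1 + e^-1 by rewrite addr_ge0 ?invr_ge0 ?ltW.
rewrite /sqsum -!ge0_esumZl -?esumD//.
  by apply: le_esum => j _; rewrite -!EFinM -EFinD lee_fin; exact: sqr_rnorm_young.
all: by move=> *; rewrite ?mule_ge0 ?lee_fin ?sqr_ge0.
Qed.

Lemma sq_young (e : R) a b : 0 < e -> l2 a -> l2 b ->
  sq (a + b) <= (1 + e) * sq a + (1 + e^-1) * sq b.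
Proof.
move=> e0 a2 b2; have := sqsum_young a b e0.
by rewrite !sqE ?l2D// -!EFinM -EFinD lee_fin.
Qed.

Lemma sqsum0 : sqsum (0 : J -> K) = 0%E.
Proof. by rewrite /sqsum esum1// => j _; rewrite rnorm0 expr0n. Qed.

Lemma sq0 : sq (0 : J -> K) = 0.
Proof. by rewrite /sq sqsum0. Qed.

Lemma l20 : l2 (0 : J -> K).
Proof. by rewrite /l2 sqsum0 ltry. Qed.

Lemma term_le_sqsum z j : ((rnorm (z j) ^+ 2)%:E <= sqsum z)%E.
Proof.
apply: esum_ge; exists [set j]; first by split.
by rewrite fsbig_set1.
Qed.

End SquareSummable.

(* [reconstructs z v] says that the analysis sequence of [v] is the orthogonal
   projection of [z] onto the range of the analysis operator; orthogonality is
   expressed by Pythagoras' identity, which is linear in [z] and [v] by the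
   parallelogram law alone, so no inner product on l^2 is needed. *)
Section Reconstruction.
Context {R : realType} {k : field_kind} {J : choiceType}.
Local Notation K := (scalarF R k).
Variables (H : completeNormedModType K) (dot : {dot H for conjF}).
Variables (W : set H) (f : J -> H) (alpha beta : R).

Definition analysis (h : H) : J -> K := fun j => dot h (f j).

Definition perp (D : J -> K) :=
  l2 D /\ forall h, W h -> sq (D + analysis h) = sq D + sq (analysis h).

Definition reconstructs z v := W v /\ perp (z - analysis v).

Definition reconstruct z : H := xget 0 [set v | reconstructs z v].

Hypothesis Wsub : closed_subspace W.
Hypothesis alpha_gt0 : 0 < alpha.
Hypothesis frameW : forall h, W h ->
  ((alpha * rnorm h ^+ 2)%:E <= sqsum (analysis h) <= (beta * rnorm h ^+ 2)%:E)%E.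

Let WD x y : W x -> W y -> W (x + y).
Proof. by case: Wsub => _ W0 WP Wx Wy; rewrite -[x]scale1r; exact: WP. Qed.

Let WZ (a : K) x : W x -> W (a *: x).
Proof. by case: Wsub => _ W0 WP Wx; rewrite -[_ *: _]addr0; exact: WP. Qed.

Let WN x : W x -> W (- x).
Proof. by rewrite -scaleN1r; exact: WZ. Qed.

Lemma analysisD x y : analysis (x + y) = analysis x + analysis y.
Proof. by apply/funext => j; exact: dotDl. Qed.

Lemma analysisZ a x : analysis (a *: x) = (fun j => a * analysis x j).
Proof. by apply/funext => j; exact: dotZl. Qed.

Lemma analysisN x : analysis (- x) = - analysis x.
Proof. by rewrite -scaleN1r analysisZ oppr_fct. Qed.

Lemma analysis_l2 h : W h -> l2 (analysis h).
Proof. by move=> /frameW/andP[_] /sqsum_le_l2[]. Qed.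

Lemma analysis_bounds h : W h ->
  alpha * rnorm h ^+ 2 <= sq (analysis h) <= beta * rnorm h ^+ 2.
Proof. by move=> Wh; have := frameW Wh; rewrite sqE ?analysis_l2// !lee_fin. Qed.

(** Let [u] be half of [analysis h]. The pairs [D + u], [D' + u] and [D], [D'] have the same
    difference, so subtracting their parallelogram laws leaves Pythagoras for [D + D'] and
    [u + u]. *)
Lemma perpD D D' : perp D -> perp D' -> perp (D + D').
Proof.
move=> [D2 DP] [D'2 D'P]; split; first exact: l2D.
move=> h Wh; have Wh2 := WZ (toF 2^-1) Wh; have h2 := analysis_l2 Wh2.
set u := analysis (toF 2^-1 *: h) in h2.
have hE : analysis h = u + u.
  rewrite -analysisD -scalerDl -toFD.
  have -> : 2^-1 + 2^-1 = 1 :> R by lra.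
  by rewrite toF1 scale1r.
have := sq_parallelogram (l2D D2 h2) (l2D D'2 h2).
have -> : D + u - (D' + u) = D - D' by rewrite opprD addrACA subrr addr0.
rewrite DP// D'P// -/u addrACA -hE.
have := sq_parallelogram D2 D'2; have := sq_parallelogram h2 h2.
rewrite subrr -hE.
by rewrite sq0; lra.
Qed.

Lemma perpZ a D : perp D -> perp (fun j => a * D j).
Proof.
move=> [D2 DP]; split; first exact: l2Z.
move=> h Wh; have [->|a0] := eqVneq a 0.
  have -> : (fun j => 0 * D j) = 0 by apply/funext => j; rewrite mul0r.
  by rewrite sq0 !add0r.
have Wah := WZ a^-1 Wh; have ah2 := analysis_l2 Wah.
have hE : analysis h = (fun j => a * analysis (a^-1 *: h) j).
  by rewrite -analysisZ scalerA mulfV// scale1r.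
have -> : (fun j => a * D j) + analysis h =
    (fun j => a * (D + analysis (a^-1 *: h)) j).
  by rewrite hE; apply/funext => j; rewrite [RHS]mulrDr.
by rewrite sqZ ?l2D// DP// hE !sqZ// mulrDr.
Qed.

Lemma reconstructs_linear a z v z' v' : reconstructs z v -> reconstructs z' v' ->
  reconstructs (fun j => a * z j + z' j) (a *: v + v').
Proof.
move=> [Wv zv] [Wv' zv']; split; first exact/WD/Wv'/WZ.
have -> : (fun j => a * z j + z' j) - analysis (a *: v + v') =
    (fun j => a * (z - analysis v) j) + (z' - analysis v').
  rewrite analysisD analysisZ opprD addrACA; congr (_ + _).
  by apply/funext => j; rewrite [RHS]mulrBr.
by apply: perpD => //; exact: perpZ.
Qed.

(** Pythagoras for [h = v] splits [sq z] into the residual and [sq (analysis v)]. *)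
Lemma reconstructs_bound z v : l2 z -> reconstructs z v ->
  alpha * rnorm v ^+ 2 <= sq z.
Proof.
move=> z2 [Wv [_ /(_ v Wv)]]; rewrite subrK => ->.
have /andP[av _] := analysis_bounds Wv.
by rewrite (le_trans av)// lerDr sq_ge0.
Qed.

Lemma reconstructs_unique z v v' :
  reconstructs z v -> reconstructs z v' -> v = v'.
Proof.
move=> zv zv'; have := reconstructs_linear (-1) zv zv'.
have -> : (fun j => -1 * z j + z j) = 0.
  by apply/funext => j; rewrite mulN1r addNr.
move=> z0.
have := reconstructs_bound (@l20 _ _ _) z0; rewrite sq0 pmulr_rle0// => le0.
apply/eqP; rewrite eq_sym -subr_eq0 addrC -scaleN1r; apply/eqP/rnorm0_eq0/eqP.
by rewrite -sqrf_eq0 eq_le le0 sqr_ge0.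
Qed.

(** Least squares: the lower frame bound is the coercivity required by [quadratic_minimum], which
    amounts to the closedness of the range. *)
Lemma reconstructs_exists z : l2 z -> exists v, reconstructs z v.
Proof.
move=> z2.
have zv2 v : W v -> l2 (z - analysis v).
  by move=> Wv; apply: l2D => //; exact/l2N/analysis_l2.
have [v Wv vP] : exists2 v, W v & forall h, W h ->
    sq (z - analysis (v + h)) = sq (z - analysis v) + sq (analysis h).
  apply: (@quadratic_minimum _ _ _ W (fun v => sq (z - analysis v))
    (fun h => sq (analysis h)) alpha beta) => //.
  - by move=> v _; exact: sq_ge0.
  - exact: analysis_bounds.
  - move=> t h Wh; rewrite analysisZ sqZ ?analysis_l2//.
    by rewrite rnorm_toF real_normK ?num_real.
  - move=> v h Wv Wh; rewrite -sq_parallelogram ?zv2 ?analysis_l2// [RHS]addrC.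
    rewrite !analysisD analysisN opprD addrA; congr (_ + sq _).
    by rewrite opprB addrCA addrC.
  - move=> e v h e0 Wv Wh; rewrite analysisD opprD addrA -(sqN (analysis h)).
    by apply: sq_young => //; [exact: zv2|exact/l2N/analysis_l2].
exists v; split=> //; split; first exact: zv2.
move=> h Wh; have := vP _ (WN Wh).
by rewrite analysisD analysisN opprD opprK addrA sqN.
Qed.

Lemma reconstructP z : l2 z -> reconstructs z (reconstruct z).
Proof.
move=> /reconstructs_exists zE.
by have := @xgetPex _ 0 [set v | reconstructs z v] zE.
Qed.

Lemma reconstruct_analysis w : W w -> reconstruct (analysis w) = w.
Proof.
move=> Ww; apply: reconstructs_unique (reconstructP (analysis_l2 Ww)) _.
split=> //; rewrite subrr.
split; last by move=> h _; rewrite sq0 !add0r.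
exact: l20.
Qed.

Lemma reconstruct_linear a z z' : l2 z -> l2 z' ->
  reconstruct (fun j => a * z j + z' j) = a *: reconstruct z + reconstruct z'.
Proof.
move=> z2 z'2; apply: reconstructs_unique (reconstructP _) _.
  exact: l2D (l2Z a z2) z'2.
by apply: reconstructs_linear; exact: reconstructP.
Qed.

Lemma reconstruct_bound z : l2 z -> alpha * rnorm (reconstruct z) ^+ 2 <= sq z.
Proof. by move=> z2; exact/reconstructs_bound/reconstructP. Qed.

End Reconstruction.

(** * Complexification of a real space *)

Section Complexification.
Variable R : realType.

(** A separate name for the product, so that it can carry a complex module structure beside its real
    one. *)
Definition cpx (V : lmodType R) : Type := (V * V)%type.

HB.instance Definition _ (V : lmodType R) :=
  GRing.Zmodule.copy (cpx V) (V * V)%type.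

Variable V : lmodType R.

(** Written as in [spectrum], so that the operators there are [l *: p - cpx_map A p] by
    conversion. *)
Definition cpx_scale (l : R[i]) (p : cpx V) : cpx V :=
  (complex.Re l *: p.1 - complex.Im l *: p.2,
   complex.Im l *: p.1 + complex.Re l *: p.2).

Lemma cpx_scaleA a b p :
  cpx_scale a (cpx_scale b p) = cpx_scale (a * b) p.
Proof.
case: a b p => [a a'] [b b'] [x y]; rewrite /cpx_scale /=; congr pair.
  rewrite !scalerBr !scalerDr !scalerA !scalerBl !scalerDl !opprD.
  by rewrite addrACA.
rewrite !scalerBr !scalerDr !scalerA !scalerBl !scalerDl.
by rewrite addrACA; congr (_ + _); exact: addrC.
Qed.

Lemma cpx_scale1 : left_id 1 cpx_scale.
Proof.
by move=> [x y]; rewrite /cpx_scale /= !scale1r !scale0r subr0 add0r.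
Qed.

Lemma cpx_scaleDr : right_distributive cpx_scale +%R.
Proof.
move=> [a a'] [x y] [x' y']; rewrite /cpx_scale /=.
by congr pair; rewrite /= !scalerDr ?opprD addrACA.
Qed.

Lemma cpx_scaleDl p : {morph cpx_scale^~ p : a b / a + b}.
Proof.
move: p => [x y] [a a'] [b b']; rewrite /cpx_scale /=.
by congr pair; rewrite /= !scalerDl ?opprD addrACA.
Qed.

HB.instance Definition _ := GRing.Zmodule_isLmodule.Build R[i] (cpx V)
  cpx_scaleA cpx_scale1 cpx_scaleDr cpx_scaleDl.

Variable A : {linear V -> V}.

Definition cpx_map (p : cpx V) : cpx V := (A p.1, A p.2).

Lemma cpx_map_is_linear : linear cpx_map.
Proof.
move=> [a a'] [x y] [x' y']; congr pair => /=;
  by rewrite linearD ?linearB ?linearD !linearZ.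
Qed.

HB.instance Definition _ :=
  GRing.isLinear.Build R[i] (cpx V) (cpx V) *:%R cpx_map cpx_map_is_linear.

Lemma iter_cpx_map n x : iter n cpx_map (x, 0) = (iter n A x, 0).
Proof. by elim: n => //= n ->; rewrite /cpx_map /= linear0. Qed.

End Complexification.

(** The inversion [l = z^-1]: for nonzero [z], [1 - z B] is [z] times [z^-1 - B]. *)
Lemma resolvent_inv (R : realType) (E : lmodType R[i]) (nrm : E -> R) (C : R)
    (B : {linear E -> E}) :
  (forall x, 0 <= nrm x) ->
  (forall z x, nrm (z *: x) <= C * cabs z * nrm x) ->
  (forall l, 1 <= cabs l -> exists S : E -> E, exists M,
     [/\ cancel (fun x => l *: x - B x) S, cancel S (fun x => l *: x - B x) &
         forall y, nrm (S y) <= M * nrm y]) ->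
  forall z, cabs z <= 1 -> exists Q : E -> E, exists M,
  [/\ forall x, Q (x - z *: B x) = x, forall y, Q y - z *: B (Q y) = y &
      forall y, nrm (Q y) <= M * nrm y].
Proof.
move=> n0 nZ res z z1; have [->|z0] := eqVneq z 0.
  by exists id, 1; split=> [x|x|x]; rewrite ?scale0r ?subr0// mul1r.
have [|S [M [SK KS SM]]] := res z^-1.
  have zp : 0 < cabs z.
    rewrite lt_def cabs_ge0 andbT; apply: contra z0 => /eqP z0.
    by rewrite -normr_eq0 -cabsE z0.
  by rewrite cabsV invf_ge1.
have zB x : x - z *: B x = z *: (z^-1 *: x - B x).
  by rewrite scalerBr scalerA mulfV// scale1r.
exists (fun y => S (z^-1 *: y)), (`|M| * (C * cabs z^-1)); split=> [x|y|y].
- by rewrite zB scalerA mulVf// scale1r SK.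
- by rewrite zB KS scalerA mulfV// scale1r.
- rewrite (le_trans (SM _))// -mulrA.
  by rewrite (le_trans (ler_wpM2r (n0 _) (ler_norm _)))// ler_wpM2l ?normr_ge0 ?nZ.
Qed.

(** * From the spectral radius to contracting powers and the inverse of [I - A] *)

Section SpectralContraction.
Variable R : realType.

Lemma cabs_ge_ReIm (z : R[i]) :
  `|complex.Re z| <= cabs z /\ `|complex.Im z| <= cabs z.
Proof.
by split; rewrite -ler_sqr ?nnegrE ?cabs_ge0// sqr_cabs real_normK ?num_real//
  ?lerDl ?lerDr sqr_ge0.
Qed.

Lemma rnorm_pair (V : normedModType (scalarF R RealScalars)) (p : V * V) :
  rnorm p = Num.max (rnorm p.1) (rnorm p.2).
Proof. by []. Qed.

Lemma rnorm_pair0 (V : normedModType (scalarF R RealScalars)) (x : V) :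
  rnorm ((x, 0) : V * V) = rnorm x.
Proof. by rewrite rnorm_pair [X in Num.max _ X]rnorm0 max_l// rnorm_ge0. Qed.

Lemma spectral_radius_invertible k (V : normedModType (scalarF R k))
    (A : V -> V) l :
  (spectral_radius A < 1)%E -> 1 <= cabs l -> ~ spectrum A l.
Proof.
move=> rA l1 Al; have : ((cabs l)%:E <= spectral_radius A)%E.
  by apply: ereal_sup_ubound; exists l.
by move=> /le_lt_trans/(_ rA); rewrite lte_fin ltNge l1.
Qed.

Lemma spectral_contraction k (V : normedModType (scalarF R k))
    (A : {linear V -> V}) : continuous A -> (spectral_radius A < 1)%E ->
  (exists m, forall x, rnorm (iter (2 ^ m) A x) <= 2^-1 * rnorm x) /\
  exists G : V -> V, exists2 c, 0 < c &
    [/\ cancel (fun x => x - A x) G, cancel G (fun x => x - A x) &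
        forall y, rnorm (G y) <= c * rnorm y].
Proof.
move=> Ac rA; have := spectral_radius_invertible rA.
have [b b0 Ab] := continuous_rnorm_bound Ac.
case: k V A Ac rA Ab => V A Ac rA Ab spec.
- have inv l : 1 <= cabs l -> exists S : cpx V -> cpx V, exists M,
     [/\ cancel (fun x => l *: x - cpx_map A x) S,
         cancel S (fun x => l *: x - cpx_map A x) &
         forall y, rnorm (S y : V * V) <= M * rnorm (y : V * V)].
    move=> /spec/contrapT [S [/continuous_rnorm_bound[M _ SM] SK KS]].
    by exists S, M.
  split.
    have [m mP] : exists m, forall p : cpx V,
        rnorm (iter (2 ^ m) (cpx_map A) p : V * V) <= 2^-1 * rnorm (p : V * V).
      pose nrm (p : cpx V) := rnorm (p : V * V).
      have nE p : nrm p = Num.max (rnorm p.1) (rnorm p.2) := rnorm_pair _.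
      (* Each component of [z *: p] has two terms, each at most [cabs z * nrm p]; hence the 2. *)
      have nZ z p : nrm (z *: p) <= 2 * cabs z * nrm p.
        have [rez imz] := cabs_ge_ReIm z.
        have p1 : rnorm p.1 <= nrm p by rewrite nE le_max lexx.
        have p2 : rnorm p.2 <= nrm p by rewrite nE le_max lexx orbT.
        have [p10 p20] := (rnorm_ge0 p.1, rnorm_ge0 p.2).
        have le u v : `|u| <= cabs z -> `|v| <= cabs z ->
            `|u| * rnorm p.1 + `|v| * rnorm p.2 <= 2 * cabs z * nrm p.
          move=> uz vz; rewrite -mulrA mulr_natl mulr2n.
          by apply: lerD; rewrite ler_pM.
        rewrite [leLHS]nE ge_max; apply/andP; split.
          by rewrite (le_trans (rnormD _ _))// rnormN !rnormZ le.
        by rewrite (le_trans (rnormD _ _))// !rnormZ le.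
      apply: (@squaring_contraction R (cpx V) nrm 2 b (cpx_map A)) => //.
      - by move=> x y; exact: (@rnormD _ _ (V * V)%type).
      - move=> a x; have -> : a%:C%C *: x = (a *: (x : V * V)%type : cpx V).
          by congr pair; rewrite /= scale0r ?subr0 ?add0r.
        exact: rnormZ.
      - by move=> x; exact: rnorm_ge0.
      - move=> [x y]; rewrite !nE ge_max /= (le_trans (Ab _))//=.
          by rewrite (le_trans (Ab _))// ler_pM2l// le_max lexx orbT.
        by rewrite ler_pM2l// le_max lexx.
      - apply: resolvent_inv nZ inv => x; exact: rnorm_ge0.
    by exists m => x; have := mP (x, 0); rewrite iter_cpx_map !rnorm_pair0.
  have [|S [M [SK KS SM]]] := inv 1; first by rewrite cabs1.
  (* The complexified inverse at [l = 1], restricted to real vectors; the maximum makes the bound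
     positive. *)
  exists (fun x => (S (x, 0)).1), (Num.max 1 M); first by rewrite lt_max ltr01.
  split=> [x|y|y].
    have -> : (x - A x, 0) = 1 *: ((x, 0) : cpx V) - cpx_map A (x, 0).
      by rewrite scale1r; congr pair; rewrite /= linear0 subr0.
    by rewrite SK.
    by have := KS (y, 0); rewrite scale1r => -[].
  have := SM (y, 0); rewrite rnorm_pair0 => Sy.
  rewrite (@le_trans _ _ (rnorm (S (y, 0) : V * V)))//.
    by rewrite [leRHS]rnorm_pair le_max lexx.
  by rewrite (le_trans Sy)// ler_wpM2r ?rnorm_ge0// le_max lexx orbT.
- have inv l : 1 <= cabs l -> exists S : V -> V, exists M,
     [/\ cancel (fun x => l *: x - A x) S,
         cancel S (fun x => l *: x - A x) &
         forall y, rnorm (S y) <= M * rnorm y].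
    move=> /spec/contrapT [S [/continuous_rnorm_bound[M _ SM] SK KS]].
    by exists S, M.
  split.
    apply: (@squaring_contraction R V rnorm 1 b A) => //.
    - by move=> x y; exact: rnormD.
    - by move=> a x; rewrite rnormZ (@rnorm_toF R ComplexScalars).
    - by move=> z x; rewrite mul1r rnormZ.
    - by move=> x; exact: rnorm_ge0.
    - apply: (@resolvent_inv R V rnorm 1) inv; first by move=> x; exact: rnorm_ge0.
      by move=> z x; rewrite rnormZ mul1r.
  have [|S [M [SK KS SM]]] := inv 1; first by rewrite cabs1.
  exists S, (Num.max 1 M); first by rewrite lt_max ltr01.
  split=> [x|y|y]; first by have := SK x; rewrite scale1r.
    by have := KS y; rewrite scale1r.
  by rewrite (le_trans (SM y))// ler_wpM2r ?rnorm_ge0// le_max lexx orbT.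
Qed.

End SpectralContraction.

(** * Limits of the rows of a matrix *)

Section RowLimits.
Context {R : realType} {k : field_kind}.
Local Notation K := (scalarF R k).
Variable L : set R.
Hypothesis L_unbounded : forall M : R, exists i : L, M < `|val i|.
Implicit Types (S T : L -> L -> K) (z : L -> K).

Lemma l2norm_sqrt z : l2 z -> l2norm z = (Num.sqrt (sq z))%:E.
Proof.
move=> z2; rewrite /l2norm -[X in (X `^ _)%E]/(sqsum z) sqE//.
by rewrite poweR_EFin powR12_sqrt// sq_ge0.
Qed.

Lemma in_l2P z : in_l2 z <-> l2 z.
Proof.
split=> [|z2]; last by rewrite /in_l2 l2norm_sqrt// ltry.
by apply: lty_poweRy; rewrite invr_eq0 pnatr_eq0.
Qed.

Lemma l2norm_le z (c : R) : 0 <= c -> (sqsum z <= (c ^+ 2)%:E)%E ->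
  (l2norm z <= c%:E)%E.
Proof.
move=> c0 /sqsum_le_l2[z2 zc]; rewrite l2norm_sqrt// lee_fin.
by rewrite -(ger0_norm c0) -sqrtr_sqr ler_wsqrtr.
Qed.

Lemma l2norm_le_sq z (c : R) : (l2norm z <= c%:E)%E -> l2 z /\ sq z <= c ^+ 2.
Proof.
move=> zc; have z2 : l2 z by apply/in_l2P; exact: le_lt_trans zc (ltry _).
split=> //; move: zc; rewrite l2norm_sqrt// lee_fin => zc.
rewrite -(sqr_sqrtr (sq_ge0 z)) ler_sqr ?nnegrE ?sqrtr_ge0//.
exact: le_trans (sqrtr_ge0 _) zc.
Qed.

(** The convergence of [Bs] in squared form, to which the Young and parallelogram estimates apply
    directly. *)
Definition row_limit T z := l2 z /\
  forall e : R, 0 < e -> exists M : R, forall i : L, M < `|val i| ->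
    (sqsum (T i - z)%R <= e%:E)%E.

Lemma Bs_row_limit T : Bs T -> exists z, row_limit T z.
Proof.
move=> [_ [z z2 zlim]]; exists z; split; first exact/in_l2P.
move=> e e0; have [|M MP] := zlim (Num.sqrt e); first by rewrite sqrtr_gt0.
exists M => i /MP/ltW/l2norm_le_sq[d2 dle]; rewrite sqE ?lee_fin//.
by move: dle; rewrite sqr_sqrtr// ltW.
Qed.

Lemma row_limit_lin (a : K) S T z z' : row_limit S z -> row_limit T z' ->
  row_limit (fun i j => a * S i j + T i j) (fun j => a * z j + z' j).
Proof.
move=> [z2 Sz] [z'2 Tz']; split; first exact: l2D (l2Z a z2) z'2.
move=> e e0; pose c := rnorm a ^+ 2 + 1.
have c0 : 0 < c by rewrite ltr_wpDl// sqr_ge0.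
have [M MP] := Sz (e / 4 / c) (divr_gt0 (divr_gt0 e0 (ltr0n R 4)) c0).
have [M' M'P] := Tz' (e / 4) (divr_gt0 e0 (ltr0n R 4)).
exists (Num.max M M') => i; rewrite gt_max => /andP[/MP Si /M'P Ti].
have [s2 sle] := sqsum_le_l2 Si; have [t2 tle] := sqsum_le_l2 Ti.
have -> : (fun j => a * S i j + T i j) - (fun j => a * z j + z' j) =
    (fun j => a * (S i - z) j) + (T i - z').
  apply/funext => j.
  have E : a * S i j + T i j - (a * z j + z' j) =
    a * (S i j - z j) + (T i j - z' j) by ring.
  exact: E.
rewrite (le_trans (sqsum_young _ _ ltr01))// sqsumZ !sqE// -!EFinM -EFinD lee_fin.
have : rnorm a ^+ 2 * sq (S i - z) <= e / 4.
  rewrite (le_trans (ler_wpM2l (sqr_ge0 _) sle))// mulrCA.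
  rewrite ler_piMr ?divr_ge0 ?(ltW e0)//.
  by rewrite ler_pdivrMr// mul1r lerDl.
by rewrite invr1; lra.
Qed.

(** Unboundedness of [L] supplies a row beyond both thresholds. The factor 2 is Young's inequality
    with parameter 1, harmless for uniqueness ([c = 0]) and for a mere bound on the limit. *)
Lemma sqsum_limit_le T z z' (c : R) : row_limit T z -> l2 z' ->
  (forall e, 0 < e -> exists M : R, forall i : L, M < `|val i| ->
     (sqsum (z' - T i)%R <= (c + e)%:E)%E) -> sq (z' - z) <= 2 * c.
Proof.
move=> [z2 Tz] z'2 z'T; apply/ler_addgt0Pr => e e0.
have [M MP] := Tz (e / 4) (divr_gt0 e0 (ltr0n R 4)).
have [M' M'P] := z'T (e / 4) (divr_gt0 e0 (ltr0n R 4)).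
have [i + ] := L_unbounded (Num.max M M').
rewrite gt_max => /andP[/MP/sqsum_le_l2[d2 dle] /M'P/sqsum_le_l2[d'2 d'le]].
have -> : z' - z = (z' - T i) + (T i - z) by rewrite addrA subrK.
by have := @sq_young _ _ _ _ _ _ ltr01 d'2 d2; rewrite invr1; lra.
Qed.

Lemma row_limit_unique T z z' : row_limit T z -> row_limit T z' -> z = z'.
Proof.
move=> Tz [z'2 Tz'].
have le0 : sq (z' - z) <= 0.
  rewrite -[X in _ <= X](mulr0 2); apply: (sqsum_limit_le Tz z'2) => e e0.
  have [M MP] := Tz' e e0; exists M => i /MP.
  by move=> /sqsum_le_l2[d2 dle]; rewrite add0r -opprB sqE ?l2N// sqN lee_fin.
have d2 : l2 (z' - z) by apply: l2D => //; apply: l2N; case: Tz.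
apply/funext => j; have := term_le_sqsum (z' - z) j.
rewrite sqE// lee_fin => /le_trans/(_ le0) d0.
apply/eqP; rewrite eq_sym -subr_eq0; apply/eqP/rnorm0_eq0/eqP.
by rewrite -sqrf_eq0 eq_le d0 sqr_ge0.
Qed.

Lemma row_limit_bound T z (m : R) : row_limit T z ->
  (forall i, (sqsum (T i) <= m%:E)%E) -> sq z <= 2 * m.
Proof.
move=> Tz Tm; rewrite -[z]opprK sqN -[- z]add0r.
apply: (sqsum_limit_le Tz l20) => e e0; exists 0 => i _.
have [T2 Tle] := sqsum_le_l2 (Tm i).
by rewrite add0r sqE ?l2N// sqN lee_fin (le_trans Tle)// lerDl ltW.
Qed.

Lemma Bs_row_bound T : Bs T ->
  exists2 m, mxnorm T = m%:E & 0 <= m /\ forall i, (sqsum (T i) <= (m ^+ 2)%:E)%E.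
Proof.
move=> [[T2 Tfin] _]; have [i0 _] := L_unbounded 0.
have le i : (l2norm (T i) <= mxnorm T)%E by apply: ereal_sup_ubound; exists i.
have ge0 : (0 <= mxnorm T)%E by rewrite (le_trans _ (le i0))// poweR_ge0.
have mE : mxnorm T = (fine (mxnorm T))%:E by rewrite fineK// ge0_fin_numE.
exists (fine (mxnorm T)) => //; split=> [|i]; first exact: fine_ge0.
have := le i; rewrite mE => /l2norm_le_sq[d2 dle].
by rewrite sqE// lee_fin.
Qed.

End RowLimits.

(** * Decay of the powers of [A] *)

Section Iterates.
Context {R : realType} {k : field_kind}.
Variables (V : normedModType (scalarF R k)) (A : {linear V -> V}).

(** Divide [n] by [p = 2 ^ m]: every full block of [p] steps halves the norm, and the remainder
    costs at most [(b + 1) ^ p], where [b + 1] is used because its powers increase. *)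
Lemma iterates_to0 : continuous A ->
  (exists m, forall x, rnorm (iter (2 ^ m) A x) <= 2^-1 * rnorm x) ->
  exists2 c, 0 < c & (forall n x, rnorm (iter n A x) <= c * rnorm x) /\
    forall e, 0 < e -> exists N, forall n x, (N <= n)%N ->
      rnorm (iter n A x) <= e * rnorm x.
Proof.
move=> /continuous_rnorm_bound[b b0 Ab] [m]; set p := (2 ^ m)%N => Ap.
have p0 : (0 < p)%N by rewrite expn_gt0.
have Ar r x : rnorm (iter r A x) <= (b + 1) ^+ r * rnorm x.
  elim: r => [|r IH] /=; first by rewrite mul1r.
  rewrite (le_trans (Ab _))// exprS -mulrA ler_pM ?rnorm_ge0 ?(ltW b0)//.
  by rewrite lerDl.
have Aq q x : rnorm (iter (q * p) A x) <= 2^-1 ^+ q * rnorm x.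
  elim: q => [|q IH]; first by rewrite mul0n mul1r.
  rewrite mulSn iterD (le_trans (Ap _))// exprS -mulrA ler_wpM2l ?invr_ge0//.
pose c := (b + 1) ^+ p.
have b1 : 1 <= b + 1 by rewrite lerDr ltW.
have An n x : rnorm (iter n A x) <= 2^-1 ^+ (n %/ p) * (c * rnorm x).
  rewrite {1}(divn_eq n p) iterD (le_trans (Aq _ _))//.
  rewrite ler_wpM2l ?exprn_ge0 ?invr_ge0// (le_trans (Ar _ _))//.
  by rewrite ler_wpM2r ?rnorm_ge0// ler_weXn2l// ltnW// ltn_pmod.
have c0 : 0 < c by rewrite exprn_gt0// (lt_le_trans ltr01).
exists c => //; split=> [n x|e e0].
  rewrite (le_trans (An n x))// ler_piMl ?mulr_ge0 ?rnorm_ge0 ?(ltW c0)//.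
  by rewrite exprn_ile1 ?invr_ge0// invf_le1// ler1n.
pose N := Num.bound (c / e).
exists (N * p)%N => n x Nn; rewrite (le_trans (An n x))// mulrA.
rewrite ler_wpM2r ?rnorm_ge0// -ler_pdivlMr// exprVn invf_ple ?posrE ?exprn_gt0
  ?divr_gt0//.
rewrite invf_div.
have D0 : 0 <= c / e by rewrite divr_ge0 ?ltW.
rewrite (le_trans (ltW (archi_boundP D0)))// -natrX ler_nat -/N.
by rewrite (@leq_trans (n %/ p))// ?leq_divRL// ltnW// ltn_expl.
Qed.

End Iterates.

(** * The frame candidates as a weak form of the inverse of [I - A] *)

Section DualFrame.
Context {R : realType} {k : field_kind}.
Local Notation K := (scalarF R k).
Variables (H : completeNormedModType K) (dot : {dot H for conjF}).
Variables (A : {linear H -> H}) (G : H -> H) (b c : R) (W : set H).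
Hypothesis dotN : hilbert_norm dot.
Hypothesis Wsub : closed_subspace W.
Hypothesis b_gt0 : 0 < b.
Hypothesis A_bounded : forall x, rnorm (A x) <= b * rnorm x.
Hypothesis c_gt0 : 0 < c.
Hypothesis G_bounded : forall x, rnorm (G x) <= c * rnorm x.
Hypothesis GK : cancel (fun x => x - A x) G.
Hypothesis KG : cancel G (fun x => x - A x).

Lemma resolvent_linear : linear G.
Proof.
move=> a x y; rewrite -[RHS]GK; congr (G _).
by rewrite linearP opprD addrACA -scalerBr !KG.
Qed.

(** [opinv] selects a preimage, so surjectivity is enough; the adjoint of [G] provides a preimage
    because [G] is a left inverse of [I - A]. *)
Lemma opinv_adjointK y :
  let h := opinv (fun x => x - adjoint dot A x) y in h - adjoint dot A h = y.
Proof.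
set T := fun x => x - adjoint dot A x.
pose GL : {linear H -> H} :=
  HB.pack G (GRing.isLinear.Build K H H *:%R G resolvent_linear).
apply: (@pinvK _ _ (fun=> 0) [set: H] T); apply/mem_set.
exists (adjoint dot GL y) => //=; rewrite /T.
set h := adjoint dot GL y.
apply/eqP; rewrite -subr_eq0; apply/eqP; set d := _ - y.
apply: rnorm0_eq0; apply/eqP; rewrite -sqrf_eq0; apply/eqP/(@toF_inj R k).
rewrite -(dot_rnorm dotN) toF0 {2}/d.
rewrite !dotBr// -(adjointP dotN _ _ b_gt0 A_bounded) -dotBl.
rewrite -(@adjointP _ _ _ _ dotN GL c _ _ c_gt0 G_bounded).
by rewrite [GL _]GK subrr.
Qed.

(** The projection is invisible to [w] in [W]; moving [I - A] across the inner product then cancels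
    it against [G]. *)
Lemma dot_dual_frame w y : W w ->
  dot w (orth_proj dot W (opinv (fun x => x - adjoint dot A x) y)) =
  dot (G w) y.
Proof.
move=> Ww; rewrite dot_orth_proj//.
set h := opinv _ _; rewrite -(opinv_adjointK y) -/h dotBr//.
by rewrite -(adjointP dotN _ _ b_gt0 A_bounded) -dotBl KG.
Qed.

End DualFrame.

(** * The states as forward orbits around the fixed point [u] *)

Section States.
Context {R : realType} {k : field_kind} {V : normedModType (scalarF R k)}.
Variables (N r : nat) (A : {linear V -> V}) (w u : V).
Hypothesis uE : A u + w = u.

Lemma LambdaNr_unbounded (M : R) : exists i : LambdaNr R N r, M < `|val i|.
Proof.
pose m := Posz (Num.bound `|M|).
exists (SigSub (mem_set (@even_LambdaNr R N r m))) => /=.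
rewrite ger0_norm ?mulr_ge0 ?ler0z// (le_lt_trans (ler_norm M))//.
rewrite (lt_le_trans (archi_boundP (normr_ge0 M)))// /m -pmulrn.
by rewrite ler_peMl// ler1n.
Qed.

Lemma iter_affine n x :
  iter n (fun y => A y + w) x = u + iter n A (x - u).
Proof.
elim: n => [|n IH] /=; first by rewrite addrC subrK.
by rewrite IH linearD /= addrAC uE.
Qed.

(** Both branches are forward orbits, started at 0 and at -2, whose number of steps grows with the
    modulus of the index. The slack 2 comes from the start at -2, and [rN] from the odd points. *)
Lemma states_iter x0 xm2 (x : LambdaNr R N r -> V) i :
  is_states A x0 xm2 w x -> exists n, exists2 y,
    y = x0 \/ y = xm2 &
    x i = u + iter n A (y - u) /\ `|val i| <= n%:R + 2 + rN R N r.
Proof.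
move=> [x1 x2 x3 x4 x5].
have rN0 : 0 <= rN R N r by rewrite divr_ge0.
pose S y := A y + w.
pose ev m : LambdaNr R N r := SigSub (mem_set (@even_LambdaNr R N r m)).
pose od m : LambdaNr R N r := SigSub (mem_set (@odd_LambdaNr R N r m)).
have step m : x (od m) = S (x (ev m)).
  by apply: x3; [exists m|rewrite /= addrC].
have evP n : x (ev (Posz n)) = iter n.*2 S x0.
  elim: n => [|n IH]; first by apply: x1; rewrite /= mulr0.
  rewrite doubleS /= -IH -step; apply: x4.
    case: n {IH} => [|n]; first by right; rewrite /= mulr0 addr0.
    by left; exists (2 * n.+1%:~R); [exists n.+1|rewrite /= addrC].
  by rewrite /= -!pmulrn -natr1; ring.
have evN n : x (ev (Negz n)) = iter n.*2 S xm2.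
  elim: n => [|n IH]; first by apply: x2; rewrite /= mulrN1.
  rewrite doubleS /= -IH -step; apply: x5.
    by exists (2 * (Negz n)%:~R); [exists (Negz n)|rewrite /= addrC].
  by rewrite /= !NegzE !rmorphN/= -!pmulrn -[n.+2%:R]natr1; ring.
have evE m : exists n, exists2 y, y = x0 \/ y = xm2 &
    x (ev m) = iter n S y /\ `|2 * m%:~R| <= n%:R + 2 :> R.
  case: m => n; exists n.*2; [exists x0; first by left|exists xm2; first by right].
    split; first exact: evP.
    by rewrite ger0_norm ?mulr_ge0// -pmulrn -muln2 natrM mulrC lerDl.
  split; first exact: evN.
  rewrite NegzE rmorphN /= -pmulrn mulrN normrN ger0_norm ?mulr_ge0 ?ler0z//.
  by rewrite -natr1 -muln2 natrM; lra.
move: i; apply: LambdaNr_ind => m l lm.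
  have -> : l = ev m by exact/val_inj.
  have [n [y y0 [xl nl]]] := evE m; exists n, y => //.
  by rewrite xl iter_affine /=; split=> //; rewrite (le_trans nl)// lerDl.
have -> : l = od m by exact/val_inj.
have [n [y y0 [xl nl]]] := evE m; exists n.+1, y => //.
rewrite step xl -[S _]/(iter n.+1 S y) iter_affine; split=> //=.
rewrite (le_trans (ler_normD _ _))// (ger0_norm rN0) addrC lerD2r.
by rewrite (le_trans nl)// lerD2r ler_nat.
Qed.

End States.

(** * The equivalence of stable recovery and the frame property *)

Theorem theorem3p21 (R : realType) (k : field_kind)
    (H : completeNormedModType (scalarF R k)) (dot : {dot H for conjF})
    (N r : nat) (g : LambdaNr R N r -> H) (beta : R) (W : set H)
    (A : {linear H -> H}) :
  (1 <= N)%N -> odd r -> coprime r N -> (1 <= r <= 2 * N - 1)%N ->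
  hilbert_norm dot -> separable_space H -> infinite_dimensional H ->
  0 < beta -> bessel dot g beta ->
  closed_subspace W ->
  continuous A -> (spectral_radius A < 1)%E ->
  (stably_recoverable dot A g W <->
   is_frame dot W
     (fun j => orth_proj dot W (opinv (fun x => x - adjoint dot A x) (g j)))).
Proof.
move=> _ _ _ _ dotN _ _ beta0 gB Wsub Ac rA.
have [contr [G [c c0 [GK KG Gc]]]] := spectral_contraction Ac rA.
have [b b0 Ab] := continuous_rnorm_bound Ac.
set f := fun j => orth_proj dot W _.
have GE w : A (G w) + w = G w by rewrite -{2}(KG w) addrC subrK.
have fE w : W w -> analysis dot f w = analysis dot g (G w).
  move=> Ww; apply/funext => j.
  exact: (dot_dual_frame dotN Wsub b0 Ab c0 Gc GK KG).
have fW j : W (f j).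
  by have [] := orth_projP dotN Wsub (opinv (fun x => x - adjoint dot A x) (g j)).
have Lu := @LambdaNr_unbounded R N r.
split=> [[Rec [Rlin [C RC]] RecP]|[_ [alpha [beta' [alpha0 _ frameW]]]]].
- split=> //.
  (* The bound [C] carries no sign, whereas a frame constant must be positive. *)
  pose C' := Num.max 1 C; have C'0 : 0 < C' by rewrite lt_max ltr01.
  exists (C' ^+ 2)^-1, (beta * c ^+ 2); split.
  + by rewrite invr_gt0 exprn_gt0.
  + by rewrite mulr_gt0// exprn_gt0.
  move=> w Ww; rewrite -[X in (_ <= X <= _)%E]/(sqsum (analysis dot f w)) fE//.
  have gG : (sqsum (analysis dot g (G w)) <= (beta * rnorm (G w) ^+ 2)%:E)%E.
    exact: gB.
  apply/andP; split; last first.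
    rewrite (le_trans gG)// lee_fin -mulrA ler_pM2l// -exprMn.
    by rewrite ler_sqr ?nnegrE ?mulr_ge0 ?rnorm_ge0 ?(ltW c0).
  pose xc : LambdaNr R N r -> H := fun=> G w.
  have const : is_states A (G w) (G w) w xc.
    by split=> *; rewrite /xc ?GE.
  have [DBs DE] := RecP _ _ _ _ Ww const.
  set D := data_matrix _ _ _ in DBs DE.
  have [g2 _] := sqsum_le_l2 gG.
  have := RC _ DBs; rewrite DE => wC.
  have : ((rnorm w)%:E <= C'%:E * l2norm (analysis dot g (G w)))%E.
    apply: (le_trans wC); apply: (@le_trans _ _ (C'%:E * mxnorm D)%E).
      have [m mE [m0 _]] := Bs_row_bound Lu DBs.
      by rewrite mE -!EFinM lee_fin ler_wpM2r// le_max lexx orbT.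
    rewrite lee_wpmul2l ?lee_fin ?(ltW C'0)//.
    by apply: ge_ereal_sup => _ [i _ <-].
  rewrite l2norm_sqrt// -EFinM lee_fin sqE// lee_fin => wq.
  rewrite ler_pdivrMl ?exprn_gt0// -(sqr_sqrtr (sq_ge0 _)) -exprMn.
  by rewrite ler_sqr ?nnegrE ?rnorm_ge0 ?mulr_ge0 ?sqrtr_ge0 ?(ltW C'0).
(* A chosen row limit, with default 0; uniqueness of limits makes the choice linear on [Bs]. *)
- pose zl (T : LambdaNr R N r -> LambdaNr R N r -> scalarF R k) :=
    xget 0 [set z | row_limit T z].
  have zlP T : Bs T -> row_limit T (zl T).
    by move=> /Bs_row_limit TE; have := @xgetPex _ 0 [set z | row_limit T z] TE.
  exists (fun T => reconstruct dot W f (zl T)); first split.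
  + move=> a S T SB TB; have [S2 T2] := (zlP S SB, zlP T TB).
    have STl := row_limit_lin a S2 T2.
    have -> : zl (fun i j => a * S i j + T i j) = (fun j => a * zl S j + zl T j).
      apply: (row_limit_unique Lu _ STl).
      by apply: xgetPex; exists (fun j => a * zl S j + zl T j).
    by apply: (reconstruct_linear Wsub alpha0 frameW); [case: S2|case: T2].
  (* Combines [alpha * rnorm v ^+ 2 <= sq z] with [sq z <= 2 * m ^+ 2]. *)
  + exists (Num.sqrt (2 / alpha)) => T TB; have Tz := zlP T TB.
    have [m mE [m0 Tm]] := Bs_row_bound Lu TB.
    rewrite mE -EFinM lee_fin.
    have z2 : l2 (zl T) by case: Tz.
    have := reconstruct_bound Wsub alpha0 frameW z2.
    have := row_limit_bound Lu Tz Tm => zm vz.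
    rewrite -ler_sqr ?nnegrE ?rnorm_ge0 ?mulr_ge0 ?sqrtr_ge0// exprMn.
    rewrite sqr_sqrtr ?divr_ge0 ?(ltW alpha0)// mulrAC ler_pdivlMr// mulrC.
    exact: le_trans zm.
  move=> x0 xm2 w x Ww xs; set u := G w.
  set D := data_matrix dot g x.
  have [c' c'0 [Anb An0]] := iterates_to0 Ac contr.
  pose B := Num.max (rnorm (x0 - u)) (rnorm (xm2 - u)).
  have xP i : exists n, exists2 y, rnorm y <= B &
      x i = u + iter n A y /\ `|val i| <= n%:R + 2 + rN R N r.
    have [n [y yx xi]] := states_iter (GE w) i xs.
    exists n, (y - u) => //.
    by case: yx => ->; rewrite /B le_max lexx ?orbT.
  have B0 : 0 <= B by rewrite /B le_max rnorm_ge0.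
  have Dz i : (sqsum (D i - analysis dot f w)%R <=
      (beta * rnorm (x i - u) ^+ 2)%:E)%E.
    rewrite fE//; have -> : D i - analysis dot g (G w) = analysis dot g (x i - u).
      by apply/funext => j; rewrite [RHS](dotBl dot).
    exact: gB.
  have Dlim (e : R) : 0 < e -> exists M : R, forall i, M < `|val i| ->
      (sqsum (D i - analysis dot f w)%R <= (e ^+ 2)%:E)%E.
    (* Decay by [e'] and the Bessel bound together give exactly [e]; [B + 1] avoids dividing by
       0. *)
    move=> e0; pose e' := e / (Num.sqrt beta * (B + 1)).
    have sb0 : 0 < Num.sqrt beta by rewrite sqrtr_gt0.
    have B10 : 0 < B + 1 by rewrite ltr_wpDl.
    have e'0 : 0 < e' by rewrite divr_gt0// mulr_gt0.
    have [n0 n0P] := An0 e' e'0.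
    exists (n0%:R + 2 + rN R N r) => i Mi.
    have [n [y yB [xi ni]]] := xP i.
    have nn0 : (n0 <= n)%N.
      by have := lt_le_trans Mi ni; rewrite !ltrD2r ltr_nat => /ltnW.
    rewrite (le_trans (Dz i))// lee_fin xi addrC addKr.
    rewrite -(sqr_sqrtr (ltW beta0)) -exprMn.
    rewrite ler_sqr ?nnegrE ?mulr_ge0 ?rnorm_ge0 ?sqrtr_ge0 ?(ltW e0)//.
    have -> : e = Num.sqrt beta * (e' * (B + 1)).
      by rewrite /e'; field; rewrite !gt_eqF.
    rewrite ler_pM2l// (le_trans (n0P n y nn0))// ler_pM2l// (le_trans yB)//.
    by rewrite lerDl.
  have fw2 : l2 (analysis dot f w) by exact: (analysis_l2 frameW Ww).
  have Dl : row_limit D (analysis dot f w).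
    split=> // e e0; have [|M MP] := Dlim (Num.sqrt e); first by rewrite sqrtr_gt0.
    by exists M => i /MP; rewrite (sqr_sqrtr (ltW e0)).
  (* A bound for all rows, not only the distant ones: Young's inequality with parameter 1 around the
     limit row. *)
  pose Q := 2 * (beta * (c' * B) ^+ 2) + 2 * sq (analysis dot f w).
  have DQ i : (sqsum (D i) <= Q%:E)%E.
    have [n [y yB [xi _]]] := xP i.
    have [d2 dle] := sqsum_le_l2 (Dz i).
    have -> : D i = (D i - analysis dot f w) + analysis dot f w by rewrite subrK.
    rewrite (sqE (l2D d2 fw2)) lee_fin (le_trans (sq_young ltr01 d2 fw2))//.
    rewrite invr1 /Q lerD2r ler_pM2l// (le_trans dle)// ler_pM2l//.
    rewrite ler_sqr ?nnegrE ?rnorm_ge0 ?mulr_ge0 ?(ltW c'0)//.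
    by rewrite xi addrC addKr (le_trans (Anb n y))// ler_pM2l.
  have Q0 : 0 <= Q.
    rewrite /Q addr_ge0// mulr_ge0 ?sq_ge0// mulr_ge0 ?sqr_ge0//.
    exact: ltW.
  have Dnorm i : (l2norm (D i) <= (Num.sqrt Q)%:E)%E.
    by apply: l2norm_le; rewrite ?sqrtr_ge0// sqr_sqrtr.
  have DB : Bs D.
    split; first split.
    + by move=> i; exact: le_lt_trans (Dnorm i) (ltry _).
    + apply: (@le_lt_trans _ _ (Num.sqrt Q)%:E); last exact: ltry.
      by apply: ge_ereal_sup => _ [i _ <-].
    exists (analysis dot f w); first exact/in_l2P.
    (* Halving [e] yields the strict inequality that [Bs] demands. *)
    move=> e e0; have [M MP] := Dlim (e / 2) (divr_gt0 e0 (ltr0n R 2)).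
    exists M => i /MP Di; apply: (@le_lt_trans _ _ (e / 2)%:E).
      by apply: l2norm_le => //; rewrite divr_ge0// ltW.
    by rewrite lte_fin ltr_pdivrMr// mulr_natr mulr2n ltrDr.
  split=> //; rewrite (row_limit_unique Lu (zlP D DB) Dl).
  exact: (reconstruct_analysis Wsub alpha0 frameW).
Qed.
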